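(* Let $\mathfrak{L}$ be a finite-dimensional semi-simple left Leibniz algebra over a field $\mathbb{F}$ of characteristic zero, and let $M$ be a finite-dimensional $\mathfrak{L}$-bimodule. Then $\mathrm{HL}^n(\mathfrak{L},M)=0$ for every integer $n\ge 2$, and there is a five-term exact sequence $$0\to M_0\to\mathrm{HL}^0(\mathfrak{L},M)\to M_{\mathrm{sym}}^{\mathfrak{L}_{\mathrm{Lie}}}\to\mathrm{Hom}_{\mathfrak{L}}(\mathfrak{L}_{\mathrm{ad},\ell},M_0)\to\mathrm{HL}^1(\mathfrak{L},M)\to 0\,.$$ Moreover, if $M$ is symmetric, then $\mathrm{HL}^n(\mathfrak{L},M)=0$ for every integer $n\ge 1$.
   Context: A left Leibniz algebra over $\mathbb{F}$ is an $\mathbb{F}$-vector space $\mathfrak{L}$ with a bilinear product satisfying $x(yz)=(xy)z+y(xz)$ for all $x,y,z$. Its Leibniz kernel is $\mathrm{Leib}(\mathfrak{L})=\langle x^2\mid x\in\mathfrak{L}\rangle_{\mathbb{F}}$, an ideal, and $\mathfrak{L}_{\mathrm{Lie}}:=\mathfrak{L}/\mathrm{Leib}(\mathfrak{L})$ is a Lie algebra. $\mathfrak{L}$ is semi-simple if $\mathrm{Leib}(\mathfrak{L})$ contains every solvable ideal of $\mathfrak{L}$ (equivalently, $\mathfrak{L}_{\mathrm{Lie}}$ is a semi-simple Lie algebra). A left $\mathfrak{L}$-module is a vector space $M$ with bilinear $(x,m)\mapsto x\cdot m$ such that $(xy)\cdot m=x\cdot(y\cdot m)-y\cdot(x\cdot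 m)$. An $\mathfrak{L}$-bimodule is a left $\mathfrak{L}$-module $M$ with a bilinear right action $(m,x)\mapsto m\cdot x$ such that $(x\cdot m)\cdot y=x\cdot(m\cdot y)-m\cdot(xy)$ and $(m\cdot x)\cdot y=m\cdot(xy)-x\cdot(m\cdot y)$. $M$ is symmetric if $m\cdot x=-x\cdot m$ for all $x,m$, and anti-symmetric if $m\cdot x=0$ for all $x,m$. The anti-symmetric kernel $M_0:=\langle x\cdot m+m\cdot x\mid x\in\mathfrak{L},m\in M\rangle_{\mathbb{F}}$ is an anti-symmetric sub-bimodule, $M_{\mathrm{sym}}:=M/M_0$ is symmetric (hence a module over $\mathfrak{L}_{\mathrm{Lie}}$), and $M_{\mathrm{sym}}^{\mathfrak{L}_{\mathrm{Lie}}}:=\{m\in M_{\mathrm{sym}}\mid x\cdot m=0\ \forall x\in\mathfrak{L}\}$. $\mathfrak{L}_{\mathrm{ad},\ell}$ is $\mathfrak{L}$ as a left $\mathfrak{L}$-module via left multiplication, and $\mathrm{Hom}_{\mathfrak{L}}(\mathfrak{L}_{\mathrm{ad},\ell},M_0)$ is the space of left $\mathfrak{L}$-module homomorphisms. Leibniz cohomology: $\mathrm{CL}^n(\mathfrak{L},M)=\mathrm{Hom}_{\mathbb{F}}(\mathfrak{L}^{\otimes n},M)$ with coboundary $(\mathrm{d}^nf)(x_1,\dots,x_{n+1})=\sum_{i=1}^n(-1)^{i+1}x_i\cdot f(x_1,\dots,\hat{x}_i,\dots,x_{n+1})+(-1)^{n+1}f(x_1,\dots,x_n)\cdot x_{n+1}+\sum_{1\le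 i<j\le n+1}(-1)^if(x_1,\dots,\hat{x}_i,\dots,x_ix_j,\dots,x_{n+1})$, where $x_ix_j$ stands in the $j$-th position; $\mathrm{HL}^n(\mathfrak{L},M)$ is its $n$-th cohomology. *)

(* Defs.v *)
From HB Require Import structures.
From mathcomp Require Import all_boot all_order all_algebra.
Set Implicit Arguments. Unset Strict Implicit. Unset Printing Implicit Defensive.
Import GRing.Theory.
Local Open Scope ring_scope.

Definition leibniz_algebra {F : fieldType} {L : vectType F} (mul : L -> L -> L) :=
  [/\ (forall (a : F) (x y z : L), mul (a *: x + y) z = a *: mul x z + mul y z),
      (forall (a : F) (x y z : L), mul z (a *: x + y) = a *: mul z x + mul z y)
    & (forall x y z : L, mul x (mul y z) = mul (mul x y) z + mul y (mul x z))].

Definition leib {F : fieldType} {L : vectType F} (mul : L -> L -> L) (v : L) : Prop :=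
  exists s : seq (F * L), v = \sum_(p <- s) p.1 *: mul p.2 p.2.

Definition is_ideal {F : fieldType} {L : vectType F} (mul : L -> L -> L)
  (I : L -> Prop) : Prop :=
  [/\ I 0, (forall (a : F) (u v : L), I u -> I v -> I (a *: u + v))
    & (forall x y : L, I y -> I (mul x y) /\ I (mul y x))].

Definition derived {F : fieldType} {L : vectType F} (mul : L -> L -> L)
  (I : L -> Prop) (v : L) : Prop :=
  exists s : seq (F * L * L),
    (forall p, p \in s -> I p.1.2 /\ I p.2) /\
    v = \sum_(p <- s) p.1.1 *: mul p.1.2 p.2.

Definition solvable_sub {F : fieldType} {L : vectType F} (mul : L -> L -> L)
  (I : L -> Prop) : Prop :=
  exists k : nat, forall v, iter k (derived mul) I v -> v = 0.

Definition semisimple {F : fieldType} {L : vectType F} (mul : L -> L -> L) : Prop :=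
  forall I : L -> Prop, is_ideal mul I -> solvable_sub mul I ->
    forall v, I v -> leib mul v.

Definition bimodule {F : fieldType} {L : vectType F} {M : vectType F}
  (mul : L -> L -> L) (lact : L -> M -> M) (ract : M -> L -> M) :=
  (forall (a : F) (x y : L) (m : M), lact (a *: x + y) m = a *: lact x m + lact y m) /\
  (forall (a : F) (x : L) (m n : M), lact x (a *: m + n) = a *: lact x m + lact x n) /\
  (forall (a : F) (x y : L) (m : M), ract m (a *: x + y) = a *: ract m x + ract m y) /\
  (forall (a : F) (x : L) (m n : M), ract (a *: m + n) x = a *: ract m x + ract n x) /\
  (forall (x y : L) (m : M), lact (mul x y) m = lact x (lact y m) - lact y (lact x m)) /\
  (forall (x y : L) (m : M), ract (lact x m) y = lact x (ract m y) - ract m (mul x y)) /\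
  (forall (x y : L) (m : M), ract (ract m x) y = ract m (mul x y) - lact x (ract m y)).

Definition symmetric_bimod {F : fieldType} {L : vectType F} {M : vectType F}
  (lact : L -> M -> M) (ract : M -> L -> M) : Prop :=
  forall x m, ract m x = - lact x m.

Definition M0 {F : fieldType} {L : vectType F} {M : vectType F}
  (lact : L -> M -> M) (ract : M -> L -> M) (v : M) : Prop :=
  exists s : seq (F * L * M),
    v = \sum_(p <- s) p.1.1 *: (lact p.1.2 p.2 + ract p.2 p.1.2).

(* CL^n(L,M) = Hom_F(L^{(x) n}, M), realised as multilinear maps (I_n -> L) -> M *)
Definition cochain {F : fieldType} (L M : vectType F) (n : nat) := ('I_n -> L) -> M.

Definition upd {L : Type} {n : nat} (x : 'I_n -> L) (k : 'I_n) (u : L) : 'I_n -> L :=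
  fun l => if l == k then u else x l.

Definition multilinear {F : fieldType} {L M : vectType F} {n : nat}
  (f : cochain L M n) : Prop :=
  forall (x : 'I_n -> L) (k : 'I_n) (a : F) (u v : L),
    f (upd x k (a *: u + v)) = a *: f (upd x k u) + f (upd x k v).

(* The coboundary d^n, with 0-based indices: for (1-based) i, the term
   (-1)^(i+1) x_i . f(..^x_i..) has 0-based index i-1 and sign (-1)^(i-1);
   x \o lift i omits the i-th argument; in the third sum x_i x_j stands in
   the position of x_j. *)
Definition coboundary {F : fieldType} {L M : vectType F}
  (mul : L -> L -> L) (lact : L -> M -> M) (ract : M -> L -> M) (n : nat)
  (f : cochain L M n) : cochain L M n.+1 :=
  fun x =>
    \sum_(i < n.+1 | (i < n)%N) (-1) ^+ i *: lact (x i) (f (x \o lift i))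
    + (-1) ^+ n.+1 *: ract (f (x \o lift ord_max)) (x ord_max)
    + \sum_(i < n.+1) \sum_(j < n.+1 | (i < j)%N)
        (-1) ^+ i.+1 *: f (upd x j (mul (x i) (x j)) \o lift i).

(* HL^(n+1)(L,M) = 0: every multilinear (n+1)-cocycle is the coboundary of a
   multilinear n-cochain *)
Definition HL_vanishes {F : fieldType} {L M : vectType F}
  (mul : L -> L -> L) (lact : L -> M -> M) (ract : M -> L -> M) (n : nat) : Prop :=
  forall f : cochain L M n.+1, multilinear f ->
    (forall x, coboundary mul lact ract f x = 0) ->
    exists g : cochain L M n, multilinear g /\
      forall x, f x = coboundary mul lact ract g x.

(* A subquotient U/W of an ambient F-space V is given by predicates U, W on V
   (W <= U subspaces).  A linear map U1/W1 -> U2/W2 is given by a function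
   f : V1 -> V2 linear on U1, with f(U1) <= U2 and f(W1) <= W2. *)

Definition sq_map {F : fieldType} {V1 V2 : lmodType F}
  (U1 W1 : V1 -> Prop) (U2 W2 : V2 -> Prop) (f : V1 -> V2) : Prop :=
  [/\ (forall (a : F) u v, U1 u -> U1 v -> f (a *: u + v) = a *: f u + f v),
      (forall u, U1 u -> U2 (f u))
    & (forall u, W1 u -> W2 (f u))].

Definition exact_at {F : fieldType} {V1 V2 V3 : lmodType F}
  (U1 : V1 -> Prop) (f : V1 -> V2) (U2 W2 : V2 -> Prop) (g : V2 -> V3)
  (W3 : V3 -> Prop) : Prop :=
  forall u, U2 u -> (W3 (g u) <-> exists v, U1 v /\ W2 (u - f v)).

Definition zero_pred {F : fieldType} {V : lmodType F} (v : V) : Prop := v = 0.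

(* HL^0 = ker d^0 (CL^0 = M, CL^{-1} = 0) *)
Definition HL0 {F : fieldType} {L M : vectType F}
  (mul : L -> L -> L) (lact : L -> M -> M) (ract : M -> L -> M) (m : M) : Prop :=
  forall x : 'I_1 -> L,
    coboundary mul lact ract (fun _ : 'I_0 -> L => m) x = 0.

(* M_sym^{L_Lie} = U/M_0 with U = {m | x.m in M_0 for all x} *)
Definition Msym_inv_lift {F : fieldType} {L M : vectType F}
  (lact : L -> M -> M) (ract : M -> L -> M) (m : M) : Prop :=
  forall x : L, M0 lact ract (lact x m).

Definition HomL_M0 {F : fieldType} {L M : vectType F}
  (mul : L -> L -> L) (lact : L -> M -> M) (ract : M -> L -> M)
  (phi : 'Hom(L, M)) : Prop :=
  (forall x, M0 lact ract (phi x)) /\ (forall x y, phi (mul x y) = lact x (phi y)).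

Definition as_cochain1 {F : fieldType} {L M : vectType F} (phi : 'Hom(L, M))
  : cochain L M 1 := fun y => phi (y ord0).

Definition Z1 {F : fieldType} {L M : vectType F}
  (mul : L -> L -> L) (lact : L -> M -> M) (ract : M -> L -> M)
  (phi : 'Hom(L, M)) : Prop :=
  forall x : 'I_2 -> L, coboundary mul lact ract (as_cochain1 phi) x = 0.

Definition B1 {F : fieldType} {L M : vectType F}
  (mul : L -> L -> L) (lact : L -> M -> M) (ract : M -> L -> M)
  (phi : 'Hom(L, M)) : Prop :=
  exists m : M, forall y : 'I_1 -> L,
    as_cochain1 phi y = coboundary mul lact ract (fun _ : 'I_0 -> L => m) y.

Definition five_term_exact {F : fieldType} {L M : vectType F}
  (mul : L -> L -> L) (lact : L -> M -> M) (ract : M -> L -> M) : Prop :=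
  let UA := M0 lact ract in let WA := @zero_pred F M in
  let UB := HL0 mul lact ract in let WB := @zero_pred F M in
  let UC := Msym_inv_lift lact ract in let WC := M0 lact ract in
  let UD := HomL_M0 mul lact ract in let WD := @zero_pred F 'Hom(L, M) in
  let UE := Z1 mul lact ract in let WE := B1 mul lact ract in
  exists (f1 : M -> M) (f2 : M -> M) (f3 : M -> 'Hom(L, M))
         (f4 : 'Hom(L, M) -> 'Hom(L, M)),
  sq_map UA WA UB WB f1 /\ sq_map UB WB UC WC f2 /\
  sq_map UC WC UD WD f3 /\ sq_map UD WD UE WE f4 /\
  (forall u, UA u -> WB (f1 u) -> WA u) /\
  exact_at UA f1 UB WB f2 WC /\
  exact_at UB f2 UC WC f3 WD /\
  exact_at UC f3 UD WD f4 WE /\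
  (forall u, UE u -> exists v, UD v /\ WE (u - f4 v)).

(* Main.v *)
Require Import Defs.
From HB Require Import structures.
From mathcomp Require Import all_boot all_order all_algebra all_field.
From mathcomp Require Import ring.
From Stdlib Require Import Classical FunctionalExtensionality.
Set Implicit Arguments. Unset Strict Implicit. Unset Printing Implicit Defensive.
Import Order.TTheory GRing.Theory Num.Theory VectorInternalTheory.
Local Open Scope ring_scope.

(* Cochains are iterated linear maps, CL (n+1) = Hom(L, CL n), on which the
   Cartan formula  i_x d f = theta_x f - d i_x f  determines d recursively.  A
   cocycle f of positive degree has theta_x f = d (i_x f), so by complete
   reducibility f is cohomologous to an invariant cocycle h.  If deg h >= 2,
   then h(xy) = theta_x (i_y h) = d (i_x i_y h), and since L = LL the map
   x |-> i_x h takes values in coboundaries; complete reducibility again lifts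
   it to an equivariant g with d (g x) = i_x h, and then d (- g) = h.  The
   five-term sequence only uses the invariant representative h in degree one.
   Complete reducibility comes from the Casimir operator of the trace form of a
   module, whose radical acts trivially by Cartan's criterion.  Over an
   arbitrary field of characteristic zero the criterion is obtained by passing
   to a splitting field of one characteristic polynomial and testing against a
   Z-linear functional on its roots. *)

(** * Identities in abelian groups *)

(** No quotient is ever formed. A representation kills the Leibniz kernel, because [rho (mul x x)]
    is the commutator of [rho x] with itself, so L can stand for its Lie quotient. Engel's theorem
    is stated relative to two stable subspaces. Complete reducibility appears only as a correction:
    a vector [f] that L moves into a submodule [K] becomes invariant after subtracting an element of
    [K]. This weak form suffices because spaces of cochains are L-modules themselves.

    Semi-simplicity speaks of solvable ideals, whereas Cartan's criterion is applied to perfect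
    ones; the derived series, which stabilizes at a perfect ideal, connects the two.

    Degree one is exceptional because an invariant 1-cocycle has no second contraction: what remains
    is an equivariant map from L to M_0. *)

Inductive zexpr := ZVar of nat | ZAdd of zexpr & zexpr | ZOpp of zexpr | ZZero.

Fixpoint zeval (V : zmodType) (env : seq V) (e : zexpr) : V :=
  match e with
  | ZVar n => env`_n
  | ZAdd e1 e2 => zeval env e1 + zeval env e2
  | ZOpp e1 => - zeval env e1
  | ZZero => 0
  end.

Fixpoint zcoef (e : zexpr) (i : nat) : int :=
  match e with
  | ZVar n => (n == i)%:Z
  | ZAdd e1 e2 => zcoef e1 i + zcoef e2 i
  | ZOpp e1 => - zcoef e1 i
  | ZZero => 0
  end.

Lemma zevalE (V : zmodType) (env : seq V) e :
  zeval env e = \sum_(0 <= i < size env) env`_i *~ zcoef e i.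
Proof.
elim: e => [n|e1 IH1 e2 IH2|e IH|] /=.
- have [lt_n|le_n] := ltnP n (size env).
    rewrite (bigD1_seq n) ?mem_index_iota ?iota_uniq //= eqxx big1 ?addr0 // => i ne.
    by rewrite eq_sym (negPf ne).
  rewrite nth_default // big_nat big1 // => i /andP[_ lt_i].
  by rewrite gtn_eqF // (leq_trans lt_i).
- by rewrite IH1 IH2 -big_split; apply: eq_bigr => i _; rewrite mulrzDr.
- by rewrite IH -sumrN; apply: eq_bigr => i _; rewrite mulrNz.
- by rewrite big1.
Qed.

(** The coefficients are closed integers even when the atoms are abstract, so the hypothesis is
    settled by computation. *)
Lemma zeval_eq (V : zmodType) (env : seq V) e1 e2 :
  all (fun i => zcoef e1 i == zcoef e2 i) (iota 0 (size env)) ->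
  zeval env e1 = zeval env e2.
Proof.
move=> /allP eqc; rewrite !zevalE; apply: eq_big_nat => i /andP[_ lt_i].
by rewrite (eqP (eqc i _)) // mem_iota.
Qed.

Ltac zmem x l :=
  lazymatch l with
  | nil => constr:(false)
  | ?y :: ?l' =>
    match goal with
    | _ => let _ := match goal with _ => unify x y end in constr:(true)
    | _ => zmem x l'
    end
  end.
Ltac zatoms t l :=
  lazymatch t with
  | @Algebra.add _ ?a ?b => let l' := zatoms a l in zatoms b l'
  | @Algebra.opp _ ?a => zatoms a l
  | @Algebra.zero _ => l
  | _ => let b := zmem t l in
    lazymatch b with true => l | false => constr:(t :: l) end
  end.
Ltac zindex x l :=
  lazymatch l with
  | ?y :: ?l' =>
    match goal with
    | _ => let _ := match goal with _ => unify x y end in constr:(0%N)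
    | _ => let n := zindex x l' in constr:(S n)
    end
  end.
Ltac zreify t l :=
  lazymatch t with
  | @Algebra.add _ ?a ?b =>
      let e1 := zreify a l in let e2 := zreify b l in constr:(ZAdd e1 e2)
  | @Algebra.opp _ ?a => let e := zreify a l in constr:(ZOpp e)
  | @Algebra.zero _ => constr:(ZZero)
  | _ => let n := zindex t l in constr:(ZVar n)
  end.
Ltac zmodule :=
  lazymatch goal with
  | |- @eq ?V ?t1 ?t2 =>
    let l1 := zatoms t1 (@nil V) in
    let l := zatoms t2 l1 in
    let e1 := zreify t1 l in
    let e2 := zreify t2 l in
    change (zeval l e1 = zeval l e2);
    apply: zeval_eq; vm_compute; reflexivity
  end.

(** * Cartan's criterion over a splitting field *)

Lemma coprimep_prod_XsubC_exp (F : fieldType) (s : seq F) (a : F) N :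
  a \notin s -> coprimep (\prod_(x <- s) ('X - x%:P) ^+ N) (('X - a%:P) ^+ N).
Proof.
move=> a_s; rewrite big_seq; elim/big_rec: _ => [|x Q xs coQ].
  exact: coprime1p.
rewrite coprimepMl coQ andbT coprimep_expl // coprimep_expr //.
by rewrite coprimep_XsubC root_XsubC; apply: contraNneq a_s => ->.
Qed.

Lemma dvdp_prod_XsubC_exp (F : fieldType) (s : seq F) N (p : {poly F}) :
  uniq s -> (forall x, x \in s -> ('X - x%:P) ^+ N %| p) ->
  \prod_(x <- s) ('X - x%:P) ^+ N %| p.
Proof.
elim: s => [|a s IHs] /=; first by rewrite big_nil dvd1p.
move=> /andP[a_s us] dv; rewrite big_cons mulrC.
rewrite Gauss_dvdp ?coprimep_prod_XsubC_exp // dv ?mem_head // andbT.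
by apply: IHs => // x xs; rewrite dv // inE xs orbT.
Qed.

Lemma chinese_poly (F : fieldType) (s : seq F) (N : nat) (g : F -> F) :
  uniq s -> exists r : {poly F},
    forall x, x \in s -> ('X - x%:P) ^+ N %| r - (g x)%:P.
Proof.
elim: s => [|a s IHs] /=; first by exists 0.
move=> /andP[a_s /IHs[r r_s]].
pose P := \prod_(x <- s) ('X - x%:P) ^+ N.
have P_s x : x \in s -> ('X - x%:P) ^+ N %| P.
  by move=> xs; rewrite /P (big_rem x) //= dvdp_mulr.
have [[u v] /= uv] := Bezout_coprimepP _ _ (coprimep_prod_XsubC_exp N a_s).
have [c c0 cE] : exists2 c, c != 0 & u * P + v * ('X - a%:P) ^+ N = c%:P.
  move: uv; rewrite -size_poly_eq1 => /size_poly1P[c c0 cE].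
  by exists c.
(* As [u * P + v * ('X - a%:P) ^+ N] is the constant [c], the factor [P * u / c] is 0 modulo the old
   moduli and 1 modulo the new one. *)
exists (r + P * u * c^-1%:P * ((g a)%:P - r)) => x; rewrite inE.
case/orP=> [/eqP->|xs].
  have -> : r + P * u * c^-1%:P * ((g a)%:P - r) - (g a)%:P
    = (P * u * c^-1%:P - 1) * ((g a)%:P - r) by ring.
  have -> : 1 = c%:P * c^-1%:P :> {poly F} by rewrite -polyCM divff.
  rewrite -cE -mulrBl [P * u]mulrC opprD addrA subrr sub0r.
  by rewrite -mulrA mulNr dvdpNr dvdp_mulr // dvdp_mull.
rewrite addrAC dvdp_addr ?r_s // -!mulrA dvdp_mulr //; exact: P_s.
Qed.

(** A binomial argument: a term of degree i + j contains [A] at least i times or [B] at least j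
    times. Induction on i + j replaces the expansion, since [A v] needs one power of [A] less and
    [B v] one power of [B] less. *)
Lemma iter_comm_sub (F : fieldType) (V : lmodType F) (A B : V -> V) :
  (forall a u v, A (a *: u + v) = a *: A u + A v) ->
  (forall a u v, B (a *: u + v) = a *: B u + B v) ->
  (forall v, A (B v) = B (A v)) ->
  forall i j v, iter i A v = 0 -> iter j B v = 0 ->
    iter (i + j) (fun u => A u - B u) v = 0.
Proof.
move=> lA lB cAB.
have A0 : A 0 = 0 by move: (lA (-1) 0 0); rewrite scaler0 addr0 scaleN1r addNr.
have B0 : B 0 = 0 by move: (lB (-1) 0 0); rewrite scaler0 addr0 scaleN1r addNr.
have iA0 n : iter n A 0 = 0 by elim: n => //= n ->.
have iB0 n : iter n B 0 = 0 by elim: n => //= n ->.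
pose D u := A u - B u.
have lD a u v : D (a *: u + v) = a *: D u + D v.
  by rewrite /D lA lB scalerBr opprD addrACA.
have D0 n : iter n D 0 = 0 by elim: n => //= n ->; rewrite /D A0 B0 subrr.
have ilin (G : V -> V) : (forall a u v, G (a *: u + v) = a *: G u + G v) ->
    forall n a u v, iter n G (a *: u + v) = a *: iter n G u + iter n G v.
  by move=> lG; elim=> //= n IHn a u v; rewrite IHn lG.
have iAB n v : iter n A (B v) = B (iter n A v) by elim: n => //= n ->.
have iBA n v : iter n B (A v) = A (iter n B v) by elim: n => //= n ->.
move=> i j; rewrite -/D; move: {2}(i + j)%N (erefl (i + j)%N) => n.
elim: n i j => [|n IHn] i j eqn v Ai Bj.
  by move: eqn Ai; case: i => //= _ ->; exact: D0.
case: i eqn Ai => [_ v0|i eqn Ai]; first by rewrite [v]v0 D0.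
case: j eqn Bj => [_ v0|j eqn Bj]; first by rewrite [v]v0 D0.
rewrite addSn iterSr.
have -> : D v = (-1) *: B v + A v by rewrite /D scaleN1r addrC.
rewrite ilin //.
have -> : iter (i + j.+1) D (A v) = 0.
  by apply: IHn; [move: eqn; rewrite addSn => -[] | rewrite -iterSr | rewrite iBA Bj A0].
have -> : iter (i + j.+1) D (B v) = 0; last by rewrite scaler0 addr0.
rewrite addnS -addSn; apply: IHn; last by rewrite -iterSr.
  by move: eqn; rewrite addSn addnS addSn => -[].
by rewrite iAB Ai B0.
Qed.

(** In a rank factorization [C *m B] of an idempotent, [B *m C] is the identity of size [\rank A],
    and the trace does not see the swap. *)
Lemma mxtrace_idempotent (F : fieldType) n (A : 'M[F]_n) :
  A *m A = A -> \tr A = (\rank A)%:R.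
Proof.
move=> idA; move: (mulmx_base A) (row_base_free A) (col_base_full A).
move: (row_base A) (col_base A) => B C cb fB fC.
have bc : B *m C = 1%:M.
  apply: (row_full_inj fC); rewrite mulmx1; apply: (row_free_inj fB).
  by rewrite -!mulmxA cb mulmxA cb idA.
by rewrite -{1}cb mxtrace_mulC bc mxtrace1.
Qed.

(** Swapping the rank factors gives a nilpotent matrix of size [\rank A] with the same trace. This
    size is smaller unless [A] is invertible, and an invertible nilpotent matrix has size 0. *)
Lemma mxtrace_nilpotent (F : fieldType) n (A : 'M[F]_n) k :
  iter k (mulmx A) 1%:M = 0 -> \tr A = 0.
Proof.
elim: {n}n.+1 {-2}n (ltnSn n) A k => // N IHN n; rewrite ltnS => le_nN A k nilA.
case: (leqP n (\rank A)) => [fullA|rA].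
  have uA : A \in unitmx by rewrite -row_full_unit -col_leq_rank.
  have: \rank (1%:M : 'M[F]_n) = 0%N.
    rewrite -(mxrank0 F n n) -nilA; elim: (k) => //= j IHj.
    by rewrite eqmxMfull // row_full_unit.
  by rewrite mxrank1 => n0; rewrite /mxtrace big1 // => -[i lt_in]; exfalso; move: lt_in; rewrite n0.
move: (mulmx_base A); move: (row_base A) (col_base A) => B C cb.
rewrite -{1}cb mxtrace_mulC.
apply: (IHN _ _ _ k.+1); first exact: leq_trans rA le_nN.
have iE j : iter j (mulmx (B *m C)) 1%:M *m B = B *m iter j (mulmx A) 1%:M.
  elim: j => [|j IHj] /=; first by rewrite mul1mx mulmx1.
  by rewrite -mulmxA IHj -!mulmxA (mulmxA C) cb.
have commi j : iter j.+1 (mulmx (B *m C)) 1%:M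
     = iter j (mulmx (B *m C)) 1%:M *m (B *m C).
  elim: j => [|j IHj]; first by rewrite /= mul1mx mulmx1.
  by rewrite iterS {1}IHj mulmxA.
by rewrite commi mulmxA iE nilA mulmx0 mul0mx.
Qed.

Section Char0.
Variables (F : fieldType) (charF : [pchar F] =i pred0).

Lemma intr_eq0_pchar0 (z : int) : (z%:~R == 0 :> F) = (z == 0).
Proof.
case: z => n; first by rewrite -pmulrn ((pcharf0P F).1 charF).
by rewrite NegzE mulrNz oppr_eq0 -pmulrn ((pcharf0P F).1 charF) //.
Qed.

End Char0.

(** Vectors of [U] outside the current [W] are adjoined until none is left; excluded middle decides
    whether one exists, and the dimension bounds the process. *)
Lemma subspace_of_pred (F : fieldType) (V : vectType F) (U : V -> Prop) :
  U 0 -> (forall a u v, U u -> U v -> U (a *: u + v)) ->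
  exists W : {vspace V}, forall v, v \in W <-> U v.
Proof.
move=> U0 Ulin.
have ext n (W : {vspace V}) : (\dim {:V} - \dim W <= n)%N ->
    (forall v, v \in W -> U v) ->
    exists W' : {vspace V}, forall v, v \in W' <-> U v.
  elim: n W => [|n IHn] W dimW WU.
    exists W => v; split; first exact: WU.
    have -> : W = fullv; last by rewrite memvf.
    by apply/eqP; rewrite eqEdim subvf -subn_eq0 -leqn0.
  case: (classic (exists2 v, U v & v \notin W)) => [[v Uv vW]|noW]; last first.
    exists W => v; split; first exact: WU.
    by move=> Uv; apply/negPn/negP => vW; apply: noW; exists v.
  apply: (IHn (<[v]> + W)%VS).
    have v0 : v != 0 by apply: contraNneq vW => ->; rewrite mem0v.
    rewrite dimv_disjoint_sum.
      by rewrite dim_vline v0 addnC addn1 subnS -ltnS; case: (_ - _)%N dimW.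
    apply/eqP; rewrite -subv0; apply/subvP => w; rewrite memv_cap.
    case/andP=> /vlineP[k ->] kvW; rewrite memv0.
    have [->|k0] := eqVneq k 0; first by rewrite scale0r.
    by case/negP: vW; rewrite -[v](scalerK k0) memvZ.
  by move=> _ /memv_addP[_ /vlineP[k ->] [w wW ->]]; apply: Ulin => //; apply: WU.
by apply: (ext (\dim {:V}) 0%VS); [rewrite leq_subr | move=> v; rewrite memv0 => /eqP->].
Qed.

(** In effect [f] is an additive map to the integers from the group generated by the [lam i],
    nonzero at [lam i0]. It takes the place of complex conjugation in the classical criterion;
    integer values make squares nonnegative whatever the field. *)
Lemma integral_functional (F : fieldType) (charF : [pchar F] =i pred0)
    k (lam : 'I_k -> F) i0 :
  lam i0 != 0 -> exists2 f : 'I_k -> int, f i0 != 0 &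
    forall c : 'I_k -> int, \sum_i lam i *~ c i = 0 -> \sum_i f i * c i = 0.
Proof.
move=> lam0.
(* The rational span of the integer relations among the [lam i]. *)
pose U (v : 'rV[rat]_k) := exists (d : int) (z : 'I_k -> int),
  [/\ d != 0, forall i, d%:~R * v 0 i = (z i)%:~R & \sum_i lam i *~ z i = 0].
have [||W WU] := @subspace_of_pred _ _ U.
- exists 1, (fun=> 0); split=> // [i|]; first by rewrite mxE mulr0.
  by rewrite big1.
- move=> a u v [d [z [d0 uz lz]]] [e [y [e0 vy ly]]].
  exists (denq a * d * e), (fun i => numq a * e * z i + denq a * d * y i).
  split; first by rewrite !mulf_neq0 ?denq_neq0.
    move=> i; rewrite !mxE !rmorphD !rmorphM /= -uz -vy numqE.
    by ring.
  rewrite (eq_bigr (fun i => lam i *~ z i *~ (numq a * e)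
    + lam i *~ y i *~ (denq a * d))).
    by rewrite big_split /= -!mulrz_suml lz ly !mul0rz addr0.
  by move=> i _; rewrite -!mulrzA -mulrzDr; congr (_ *~ _); ring.
pose e i : 'rV[rat]_k := delta_mx 0 i.
have eW : e i0 \notin W.
  apply/negP=> /WU[d [z [d0 ez lz]]]; case/negP: lam0.
  have zE i : z i = d * (i == i0).
    by apply/eqP; rewrite -(eqr_int rat) -ez mxE eqxx rmorphM /= -pmulrn.
  move: lz; rewrite (bigD1 i0) //= big1 => [|i /negPf ne].
    rewrite zE eqxx mulr1 addr0 -mulrzl => /eqP.
    by rewrite mulf_eq0 (intr_eq0_pchar0 charF) (negPf d0).
  by rewrite zE ne mulr0 mulr0z.
(* This residue vanishes exactly on [W]; one of its coordinates, multiplied by a common denominator,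
   will be [f]. *)
pose g v := v - projv W v.
have gE (c : 'I_k -> rat) : g (\row_i c i) = \sum_i c i *: g (e i).
  rewrite /g [X in X - projv W X]row_sum_delta linear_sum -sumrB.
  by apply: eq_bigr => i _; rewrite mxE linearZ scalerBr.
have [j gj] : exists j, g (e i0) 0 j != 0.
  have: g (e i0) != 0.
    by apply: contraNneq eW => /eqP; rewrite subr_eq0 => /eqP->; apply: memv_proj.
  by case/rV0Pn=> j gj; exists j.
pose r i := g (e i) 0 j.
pose N := \prod_i denq (r i).
pose f i := numq (r i) * \prod_(l | l != i) denq (r l).
have N0 : N != 0 by apply/prodf_neq0 => i _; apply: denq_neq0.
have fE i : (f i)%:~R = r i * N%:~R.
  by rewrite /f /N [in RHS](bigD1 i) //= !intrM mulrA -numqE.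
exists f => [|c lc]; first by rewrite -(intr_eq0 rat) fE mulf_neq0 // intr_eq0.
have: (\row_i (c i)%:~R : 'rV[rat]_k) \in W.
  apply/WU; exists 1, c; split=> // i; by rewrite mxE mul1r.
move=> /projv_id cW; apply/eqP; rewrite -(intr_eq0 rat) rmorph_sum /=.
have: g (\row_i (c i)%:~R) 0 j = 0 by rewrite /g cW subrr mxE.
rewrite gE summxE => {}cW.
rewrite (eq_bigr (fun i => ((c i)%:~R *: g (e i)) 0 j * N%:~R)).
  by rewrite -mulr_suml cW mul0r.
by move=> i _; rewrite intrM fE mxE /r; ring.
Qed.

(** On a generalized eigenvector for [a], a polynomial acts through its residue modulo
    [('X - a%:P) ^+ N]. *)
Lemma mulmx_horner_interp (F : fieldType) k m (T : 'M[F]_k.+1)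
    (z : 'M_(m, k.+1)) a N (r : {poly F}) c :
  z *m (T - a%:M) ^+ N = 0 -> ('X - a%:P) ^+ N %| r - c%:P ->
  z *m horner_mx T r = c *: z.
Proof.
move=> zT /dvdpP[q rE]; have -> : r = ('X - a%:P) ^+ N * q + c%:P.
  by rewrite mulrC -rE subrK.
rewrite rmorphD rmorphM rmorphXn rmorphB /= horner_mx_X !horner_mx_C.
by rewrite mulmxDr mulmxA zT mul0mx add0r mul_mx_scalar.
Qed.

(** A root of an irreducible factor is adjoined and its linear factor divided out, repeatedly; the
    induction therefore ranges over all fields. The irreducible factor is found by excluded
    middle. *)
Lemma splitting_ext (F : fieldType) (p : {poly F}) : p != 0 ->
  exists (K : fieldType) (iota : {rmorphism F -> K}) (rs : seq K),
    map_poly iota p %= \prod_(x <- rs) ('X - x%:P).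
Proof.
have irr_factor (E : fieldType) (q : {poly E}) : (1 < size q)%N ->
    exists2 d, irreducible_poly d & d %| q.
  elim: {q}(size q) {-2}q (leqnn (size q)) => [|n IHn] q le_qn q_gt1.
    by move: le_qn q_gt1; rewrite leqn0 => /eqP->.
  case: (classic (irreducible_poly q)) => [iq|nq]; first by exists q.
  have q0 : q != 0 by rewrite -size_poly_gt0 ltnW.
  have [d [d1 dq nd]] : exists d : {poly E}, [/\ size d != 1%N, d %| q & ~~ (d %= q)].
    apply: NNPP => no; apply: nq; split=> // d d1 dq.
    by apply/negPn/negP => nd; apply: no; exists d.
  have lt_dq : (size d < size q)%N.
    by rewrite ltn_neqAle dvdp_leq // andbT dvdp_size_eqp.
  have [||e ie ed] := IHn d; first by rewrite -ltnS (leq_trans lt_dq).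
    by rewrite ltn_neqAle eq_sym d1 size_poly_gt0 (dvdpN0 dq).
  by exists e => //; apply: dvdp_trans ed dq.
move: {2}(size p) (leqnn (size p)) => n.
elim: n F p => [|n IHn] F p le_pn p0.
  by move: le_pn; rewrite leqn0 size_poly_eq0 (negPf p0).
have [p_le1|p_gt1] := leqP (size p) 1.
  exists F, idfun, [::]; rewrite big_nil map_poly_id //.
  by rewrite -size_poly_eq1 eqn_leq p_le1 size_poly_gt0.
have [q iq /dvdpP[u pE]] := irr_factor _ _ p_gt1.
have [L _ [z qz _]] := irredp_FAdjoin iq.
pose io : {rmorphism F -> L} := in_alg L.
have /factor_theorem[p1 p1E] : root (map_poly io p) z.
  by rewrite pE rmorphM /= rootM qz orbT.
have p10 : p1 != 0.
  by apply: contraNneq p0 => p10; rewrite -(map_poly_eq0 io) p1E p10 mul0r.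
have [|K [io' [rs rsE]]] := IHn L p1 _ p10.
  have: size (map_poly io p) = (size p1).+1.
    by rewrite p1E size_Mmonic ?monicXsubC // size_XsubC addn2.
  by rewrite size_map_poly => sp; rewrite -ltnS -sp.
exists K, (io' \o io : {rmorphism F -> K}), (io' z :: rs).
rewrite map_poly_comp p1E rmorphM /= big_cons rmorphB /= map_polyX map_polyC /=.
by rewrite mulrC eqp_mull.
Qed.

Section CartanSplit.
Variables (F : fieldType) (charF : [pchar F] =i pred0) (n m : nat).
Variables (X : 'I_m -> 'M[F]_n.+1) (Y : 'M[F]_n.+1) (rs : seq F).
Hypothesis bracketX : forall i j, exists c : 'I_m -> F,
  X i * X j - X j * X i = \sum_l c l *: X l.
Hypothesis traceX : forall i j, \tr (X i * X j) = 0.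
Hypothesis Yspan : exists a : 'I_m -> F, Y = \sum_i a i *: X i.
Hypothesis Ybracket : exists b : 'I_m -> 'I_m -> F,
  Y = \sum_i \sum_j b i j *: (X i * X j - X j * X i).
Hypothesis charY : char_poly Y = \prod_(x <- rs) ('X - x%:P).

Let s := undup rs.
Let N := size rs.
Let k := size s.
Let lam (i : 'I_k) := s`_i.

Let lam_inj : injective lam.
Proof. by move=> i j /eqP; rewrite nth_uniq ?undup_uniq // => /eqP/val_inj. Qed.

Let mem_lam i : lam i \in s. Proof. exact: mem_nth. Qed.

Let lamP x : x \in s -> exists i, x = lam i.
Proof.
by rewrite -index_mem => lt; exists (Ordinal lt); rewrite /lam nth_index // -index_mem.
Qed.

Let hornerY0 p : (forall i, ('X - (lam i)%:P) ^+ N %| p) -> horner_mx Y p = 0.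
Proof.
move=> dv; suff /dvdpP[q ->] : char_poly Y %| p.
  by rewrite rmorphM /= Cayley_Hamilton mulr0.
apply: (@dvdp_trans _ (\prod_(x <- s) ('X - x%:P) ^+ N)); last first.
  by apply: dvdp_prod_XsubC_exp; [exact: undup_uniq | move=> _ /lamP[i ->]].
rewrite charY -big_undup_iterop_count.
apply: (big_ind2 (fun p q : {poly F} => p %| q)) => // [p1 p2 q1 q2|x _].
  exact: dvdp_mul.
by apply: dvdp_exp2l; rewrite count_size.
Qed.

(** Evaluated at [Y], these polynomials become the projections onto the generalized eigenspaces. *)
Let e_ex : exists e : 'I_k -> {poly F}, forall i j,
  ('X - (lam j)%:P) ^+ N %| e i - (j == i)%:R%:P.
Proof.
have ex_e i : exists r : {poly F}, forall j,
    ('X - (lam j)%:P) ^+ N %| r - (j == i)%:R%:P.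
  have [r rP] := chinese_poly N (fun x => (x == lam i)%:R) (undup_uniq rs).
  by exists r => j; rewrite -(inj_eq lam_inj); apply: rP.
by have [e eP] := fin_all_exists ex_e; exists e.
Qed.

(** The exponent [N + N] is the nilpotency bound for a difference of two commuting operators, each
    killed by its [N]-th power: left and right multiplication by [Y] minus an eigenvalue. *)
Let r_ex (f : 'I_k -> int) :
    (forall c : 'I_k -> int, \sum_i lam i *~ c i = 0 -> \sum_i f i * c i = 0) ->
  exists r : {poly F}, forall i j,
    ('X - (lam i - lam j)%:P) ^+ (N + N) %| r - (f i - f j)%:~R%:P.
Proof.
move=> fP.
pose g x : F := if [pick p : 'I_k * 'I_k | x == lam p.1 - lam p.2] is Some p
  then (f p.1 - f p.2)%:~R else 0.
have gE i j : g (lam i - lam j) = (f i - f j)%:~R.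
  rewrite /g; case: pickP => [[i' j'] /= /eqP eqd|/(_ (i, j))]; last by rewrite eqxx.
  (* Well-definedness of [g]: [fP] is applied to the relation
     [lam i - lam j - (lam i' - lam j') = 0]. *)
  congr _%:~R; apply/eqP; rewrite eq_sym -subr_eq0; apply/eqP.
  pose d (l : 'I_k) (x : 'I_k) : int := (x == l)%:R.
  have sd (G : 'I_k -> int) l : \sum_x G x * d l x = G l.
    rewrite (bigD1 l) //= /d eqxx mulr1 big1 ?addr0 // => x /negPf->.
    by rewrite mulr0.
  have sl l : \sum_x lam x *~ d l x = lam l.
    rewrite (bigD1 l) //= /d eqxx mulr1z big1 ?addr0 // => x /negPf->.
    by rewrite mulr0z.
  have := fP (fun x => d i x - d j x - (d i' x - d j' x)).
  under eq_bigr do rewrite !mulrzBr; rewrite !sumrB !sl eqd subrr => /(_ erefl).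
  by under eq_bigr do rewrite !mulrBr; rewrite !sumrB !sd.
pose D := undup [seq lam p.1 - lam p.2 | p : 'I_k * 'I_k].
have [r rP] := chinese_poly (N + N) g (undup_uniq _ : uniq D).
exists r => i j; rewrite -gE; apply: rP.
by rewrite mem_undup; apply/imageP; exists (i, j).
Qed.

(** [S] has integer eigenvalues [f i] where [Y] has [lam i]. Since [Y] is a sum of brackets and
    [ad S] preserves the span of the [X i], the trace hypothesis gives [\tr (Y * S) = 0]; applying
    [f] to this relation yields a vanishing sum of squares. *)
Lemma trace_form_zero_eigenvalue0 x : x \in rs -> x = 0.
Proof.
rewrite -mem_undup => /lamP[i0 ->]; apply/eqP/negPn/negP => lam0.
have [f f0 fP] := integral_functional charF lam0.
have [e eP] := e_ex; have [r rP] := r_ex fP.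
pose pi i := horner_mx Y (e i).
have dvd_e i j : i != j -> ('X - (lam j)%:P) ^+ N %| e i.
  by move=> ne; have := eP i j; rewrite eq_sym (negPf ne) polyC0 subr0.
have pi_sum : \sum_i pi i = 1.
  apply/eqP; rewrite -subr_eq0 -rmorph_sum -(rmorph1 (horner_mx Y)) -rmorphB /=.
  apply/eqP/hornerY0 => j; rewrite (bigD1 j) //= addrAC dvdp_addr.
    elim/big_rec: _ => [|i p ne dp]; first exact: dvdp0.
    by rewrite dvdp_addr ?dvd_e.
  by have := eP j j; rewrite eqxx polyC1.
have pi_idem i : pi i * pi i = pi i.
  apply/eqP; rewrite -subr_eq0 -rmorphM -rmorphB /=; apply/eqP/hornerY0 => j.
  have -> : e i * e i - e i = e i * (e i - 1) by rewrite mulrBr mulr1.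
  have [<-|ne] := eqVneq i j; last by rewrite dvdp_mulr // dvd_e.
  by rewrite dvdp_mull //; have := eP i i; rewrite eqxx polyC1.
have YE a : Y - a%:M = horner_mx Y ('X - a%:P).
  by rewrite rmorphB /= horner_mx_X horner_mx_C.
have pi_nil i : (Y - (lam i)%:M) ^+ N * pi i = 0.
  rewrite YE -rmorphXn -rmorphM /=.
  apply: hornerY0 => j; have [<-|ne] := eqVneq i j; first by rewrite dvdp_mulr.
  by rewrite dvdp_mull // dvd_e.
have pi_comm i a : pi i * (Y - a%:M) = (Y - a%:M) * pi i.
  by rewrite YE -!rmorphM mulrC.
pose S := \sum_i (f i)%:~R *: pi i.
(* ad S is a polynomial in ad Y, because both act on pi_i Z pi_j with the
   generalized eigenvalues f i - f j and lam i - lam j. *)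
have [K [vec [T [vecI vecT]]]] : exists K (vec : {linear 'M[F]_n.+1 -> 'rV[F]_K.+1})
    (T : 'M[F]_K.+1), injective vec /\ forall Z, vec Z *m T = vec (Y * Z - Z * Y).
  (* [K.+1] unfolds to [n.+1 * n.+1], in the successor form that [horner_mx] requires. *)
  exists (n + n * n.+1)%N, (@mxvec F n.+1 n.+1), (lin_mx (mulmx Y \- mulmxr Y)).
  by split=> [|Z]; [apply: can_inj mxvecK | exact: (mul_vec_lin (mulmx Y \- mulmxr Y) Z)].
have adS Z : vec Z *m horner_mx T r = vec (S * Z - Z * S).
  have -> : Z = \sum_i \sum_j pi i * Z * pi j.
    under eq_bigr do rewrite -mulr_sumr pi_sum mulr1.
    by rewrite -mulr_suml pi_sum mul1r.
  rewrite mulr_sumr mulr_suml -sumrB !linear_sum mulmx_suml /=.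
  apply: eq_bigr => i _; rewrite mulr_sumr mulr_suml -sumrB !linear_sum mulmx_suml.
  apply: eq_bigr => j _; set Zij := pi i * Z * pi j.
  have piE a b : pi a * pi b = (a == b)%:R *: pi b.
    have [->|ne] := eqVneq a b; first by rewrite scale1r pi_idem.
    rewrite scale0r -rmorphM /=; apply: hornerY0 => l.
    have [<-|nel] := eqVneq a l; last by rewrite dvdp_mulr // dvd_e.
    by rewrite dvdp_mull // dvd_e // eq_sym.
  have SZ : S * Zij = (f i)%:~R *: Zij.
    rewrite /S /Zij mulr_suml (bigD1 i) //= big1 => [|l ne].
      by rewrite addr0 !mulrA -!scalerAl pi_idem.
    by rewrite !mulrA -!scalerAl piE (negPf ne) scale0r !mul0r scaler0.
  have ZS : Zij * S = (f j)%:~R *: Zij.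
    rewrite /S /Zij mulr_sumr (bigD1 j) //= big1 => [|l ne].
      by rewrite addr0 -!mulrA -!scalerAr pi_idem.
    by rewrite -!mulrA -!scalerAr piE eq_sym (negPf ne) scale0r !mulr0 scaler0.
  rewrite SZ ZS -scalerBl -intrB linearZ /=.
  apply: mulmx_horner_interp (rP i j).
  pose A (W : 'M[F]_n.+1) := (Y - (lam i)%:M) * W.
  pose B (W : 'M[F]_n.+1) := W * (Y - (lam j)%:M).
  have iA a W : iter a A W = (Y - (lam i)%:M) ^+ a * W.
    by elim: a => [|a IHa]; rewrite ?mul1r //= IHa /A mulrA exprS.
  have iB a W : iter a B W = W * (Y - (lam j)%:M) ^+ a.
    by elim: a => [|a IHa]; rewrite ?mulr1 //= IHa /B -mulrA exprSr.
  have iT a W : vec W *m (T - (lam i - lam j)%:M) ^+ a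
      = vec (iter a (fun U => A U - B U) W).
    elim: a => [|a IHa]; first by rewrite expr0 mulmx1.
    rewrite exprSr mulmxA IHa /=; set U := iter _ _ _.
    rewrite mulmxBr vecT mul_mx_scalar -linearZ -linearB /=; congr (vec _).
    rewrite /A /B mulrBl mulrBr -!mulmxE mul_scalar_mx mul_mx_scalar scalerBl.
    by rewrite !opprB [X in _ + X = _]addrC addrACA [X in _ + X = _]addrC.
  rewrite iT iter_comm_sub ?linear0 //.
  - by move=> a u v; rewrite /A mulrDr -scalerAr.
  - by move=> a u v; rewrite /B mulrDl -scalerAl.
  - by move=> v; rewrite /A /B mulrA.
  - by rewrite iA /Zij !mulrA pi_nil !mul0r.
  - rewrite iB /Zij -!mulrA.
    have -> : pi j * (Y - (lam j)%:M) ^+ N = 0; last by rewrite !mulr0.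
    by rewrite (commrX N (pi_comm j (lam j))) pi_nil.
(* The rows of [R] span the algebra. It is stable under [ad Y] because [Y] belongs to it, hence
   under every polynomial in [ad Y], although [S] itself need not belong to it. *)
pose R := \matrix_(i < m) vec (X i).
have XR i : row i R = vec (X i) by rewrite rowK.
have stabR : stablemx R T.
  have [a YX] := Yspan.
  apply/row_subP => l; rewrite row_mul XR vecT YX.
  rewrite mulr_suml mulr_sumr -sumrB linear_sum summx_sub // => i _.
  rewrite -scalerAl -scalerAr -scalerBr linearZ scalemx_sub //=.
  have [c ->] := bracketX i l; rewrite linear_sum summx_sub // => h _.
  by rewrite linearZ scalemx_sub //= -XR row_sub.
have stabr p : stablemx R (horner_mx T p).
  elim/poly_ind: p => [|p c IHp]; first by rewrite rmorph0 stablemx0.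
  rewrite rmorphD rmorphM /= horner_mx_X horner_mx_C.
  by rewrite stablemxD ?stablemxC // stablemxM.
have tr0 i j : \tr (X i * (X j * S - S * X j)) = 0.
  have: (vec (S * X j - X j * S) <= R)%MS.
    rewrite -adS -XR -row_mul.
    exact: submx_trans (row_sub _ _) (stabr _).
  case/submxP => c cE.
  have -> : X j * S - S * X j = - \sum_l c 0 l *: X l.
    rewrite -opprB; congr (- _); apply: vecI.
    rewrite cE mulmx_sum_row linear_sum; apply: eq_bigr => l _.
    by rewrite XR linearZ.
  rewrite mulrN linearN /= mulr_sumr linear_sum big1 ?oppr0 // => l _.
  by rewrite -scalerAr linearZ /= traceX mulr0.
have trYS : \tr (Y * S) = 0.
  have [b ->] := Ybracket; rewrite mulr_suml linear_sum big1 // => i _.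
  rewrite mulr_suml linear_sum big1 // => j _.
  rewrite -scalerAl linearZ /=; apply/eqP; rewrite mulf_eq0; apply/orP; right.
  rewrite mulrBl linearB /= -!mulrA [X in _ - X]mxtrace_mulC -!mulmxE -mulmxA.
  by rewrite -linearB /= -mulmxBr; apply/eqP; apply: tr0.
(* [Y * pi i] is nilpotent plus [lam i *: pi i], and the trace of an idempotent is its rank. *)
have trYpi i : \tr (Y * pi i) = lam i *+ \rank (pi i).
  have -> : Y * pi i = (Y - (lam i)%:M) * pi i + lam i *: pi i.
    by rewrite mulrBl -mulmxE mul_scalar_mx subrK.
  rewrite linearD /= (@mxtrace_nilpotent _ _ _ N.+1); last first.
    have iE a : iter a (mulmx ((Y - (lam i)%:M) * pi i)) 1%:M
        = ((Y - (lam i)%:M) * pi i) ^+ a.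
      by elim: a => //= a ->; rewrite exprS.
    rewrite iE YE -rmorphM -rmorphXn /=; apply: hornerY0 => j.
    rewrite exprMn; have [<-|ne] := eqVneq i j.
      by rewrite exprSr -mulrA dvdp_mulr.
    by rewrite [e i ^+ _]exprSr mulrA dvdp_mull // dvd_e.
  by rewrite add0r linearZ /= mxtrace_idempotent ?mulmxE // mulr_natr.
have pi0 : pi i0 != 0.
  have : eigenvalue Y (lam i0).
    by rewrite eigenvalue_root_char charY root_prod_XsubC -mem_undup.
  case/eigenvalueP=> v vY v0; apply: contraNneq v0 => pi0.
  have: v *m pi i0 = 1 *: v.
    apply: (@mulmx_horner_interp _ _ _ _ _ (lam i0) 1).
      by rewrite expr1 mulmxBr vY mul_mx_scalar subrr.
    have := eP i0 i0; rewrite eqxx; apply: dvdp_trans; apply: dvdp_exp2l.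
    exact: leq_trans (leq_ltn_trans (leq0n i0) (ltn_ord i0)) (size_undup rs).
  by rewrite pi0 mulmx0 scale1r => <-.
(* The relation fed to [f] is [\tr (Y * S) = 0], whose left side is the sum of the [lam i] with
   integer weights [f i * \rank (pi i)]. *)
have : \sum_i f i * (f i * (\rank (pi i))%:Z) = 0.
  apply: fP; rewrite -[RHS]trYS /S mulr_sumr linear_sum; apply: eq_bigr => i _.
  rewrite -scalerAr linearZ /= trYpi -mulr_natr mulrA -mulrzl intrM.
  by rewrite -pmulrn mulrC mulrA [_ * lam i]mulrC.
move/eqP; rewrite psumr_eq0 => [/allP/(_ i0)|i _]; last first.
  by rewrite mulrA mulr_ge0 // -expr2 sqr_ge0.
rewrite mem_index_enum => /(_ isT); rewrite !mulf_eq0 (negPf f0) /= eqz_nat.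
by rewrite mxrank_eq0 (negPf pi0).
Qed.

End CartanSplit.

(** * Engel's theorem and Cartan's criterion *)

(** The hypotheses are equations over [F], so they survive in a splitting field of [char_poly Y].
    There every root is 0, and Cayley-Hamilton applies to a power of ['X]. *)
Lemma trace_form_zero_nilpotent (F : fieldType) (charF : [pchar F] =i pred0)
    n m (X : 'I_m -> 'M[F]_n) (Y : 'M[F]_n) :
  (forall i j, exists c : 'I_m -> F,
     X i *m X j - X j *m X i = \sum_l c l *: X l) ->
  (forall i j, \tr (X i *m X j) = 0) ->
  (exists a : 'I_m -> F, Y = \sum_i a i *: X i) ->
  (exists b : 'I_m -> 'I_m -> F,
     Y = \sum_i \sum_j b i j *: (X i *m X j - X j *m X i)) ->
  iter n (mulmx Y) 1%:M = 0.
Proof.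
case: n X Y => [|n] X Y brX trX Ysp Ybr; first by apply/matrixP; case.
have [K [io [rs rsE]]] := splitting_ext (monic_neq0 (char_poly_monic Y)).
have charK : [pchar K] =i pred0 by move=> p; rewrite (fmorph_pchar io) charF.
have charY : char_poly (map_mx io Y) = \prod_(x <- rs) ('X - x%:P).
  rewrite -map_char_poly; apply/eqP; rewrite -eqp_monic //.
    by rewrite map_char_poly char_poly_monic.
  exact: monic_prod_XsubC.
have io_inj : injective (@map_mx _ _ io n.+1 n.+1) by move=> ? ?; apply: map_mx_inj.
have rs0 x : x \in rs -> x = 0.
  apply: (@trace_form_zero_eigenvalue0 K charK n m (fun i => map_mx io (X i)) (map_mx io Y)).
  - move=> i j; have [c cE] := brX i j; exists (io \o c).
    rewrite -!mulmxE -!map_mxM -map_mxB cE map_mx_sum; apply: eq_bigr => l _.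
    by rewrite map_mxZ.
  - by move=> i j; rewrite -mulmxE -map_mxM trace_map_mx trX rmorph0.
  - have [a ->] := Ysp; exists (io \o a); rewrite map_mx_sum.
    by apply: eq_bigr => l _; rewrite map_mxZ.
  - have [b ->] := Ybr; exists (fun i j => io (b i j)); rewrite map_mx_sum.
    apply: eq_bigr => i _; rewrite map_mx_sum; apply: eq_bigr => j _.
    by rewrite map_mxZ map_mxB !map_mxM.
  - exact: charY.
have YX : char_poly (map_mx io Y) = 'X^(size rs).
  rewrite charY big_seq (eq_bigr (fun=> 'X)) => [|x /rs0->]; last by rewrite subr0.
  by rewrite -big_seq big_const_seq count_predT iter_mulr_1.
have sz : size rs = n.+1.
  by have := size_char_poly (map_mx io Y); rewrite YX size_polyXn => -[].
have itE j : iter j (mulmx Y) 1%:M = Y ^+ j by elim: j => //= j ->; rewrite exprS.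
apply: io_inj; rewrite itE rmorphXn /= raddf0.
by have := Cayley_Hamilton (map_mx io Y); rewrite YX sz rmorphXn /= horner_mx_X.
Qed.

Lemma linfun_linE (F : fieldType) (U V : vectType F) (f : U -> V) :
  (forall a u v, f (a *: u + v) = a *: f u + f v) -> linfun f =1 f.
Proof.
move=> lf; pose g : {linear U -> V} := HB.pack f (GRing.isLinear.Build F U V *:%R f lf).
exact: (lfunE g).
Qed.

Section Engel.
Variable F : fieldType.

Definition lbr (V : vectType F) (p q : 'End(V)) : 'End(V) := (p \o q)%VF - (q \o p)%VF.

Lemma lbrE (V : vectType F) (p q : 'End(V)) v : lbr p q v = p (q v) - q (p v).
Proof. by rewrite /lbr add_lfunE opp_lfunE !comp_lfunE. Qed.

Lemma lbr_linl (V : vectType F) a (p p' q : 'End(V)) :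
  lbr (a *: p + p') q = a *: lbr p q + lbr p' q.
Proof.
apply/lfunP => v; rewrite !(lbrE, add_lfunE, scale_lfunE) linearP.
by rewrite scalerBr opprD addrACA.
Qed.

Lemma lbr_linr (V : vectType F) a (p q q' : 'End(V)) :
  lbr p (a *: q + q') = a *: lbr p q + lbr p q'.
Proof.
apply/lfunP => v; rewrite !(lbrE, add_lfunE, scale_lfunE) linearP.
by rewrite scalerBr opprD addrACA.
Qed.

Lemma lbr_anti (V : vectType F) (p q : 'End(V)) : lbr p q = - lbr q p.
Proof. by rewrite /lbr opprB. Qed.

Definition lbr_closed (V : vectType F) (P : {vspace 'End(V)}) : Prop :=
  forall p q, p \in P -> q \in P -> lbr p q \in P.

Definition lnilp (V : vectType F) (p : 'End(V)) : Prop :=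
  exists k, forall v, iter k p v = 0.

Definition ad (V : vectType F) : 'Hom('End(V), 'End('End(V))) :=
  linfun (fun p => linfun (lbr p)).

Lemma adE (V : vectType F) (p q : 'End(V)) : ad V p q = lbr p q.
Proof.
rewrite /ad linfun_linE => [|a u v]; first by apply: linfun_linE => a u v; apply: lbr_linr.
apply/lfunP => w; rewrite add_lfunE scale_lfunE !linfun_linE ?lbr_linl // => b x y;
  exact: lbr_linr.
Qed.

(** [ad p] is the difference of left and right composition with [p], which commute. *)
Lemma lnilp_ad (V : vectType F) (p : 'End(V)) : lnilp p -> lnilp (ad V p).
Proof.
case=> k pk; exists (k + k)%N => z.
rewrite (@eq_iter _ _ (fun u => (p \o u)%VF - (u \o p)%VF)); last first.
  by move=> u; rewrite adE.
apply: iter_comm_sub.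
- by move=> a u v; rewrite comp_lfunDr comp_lfunZr.
- by move=> a u v; rewrite comp_lfunDl comp_lfunZl.
- by move=> v; rewrite comp_lfunA.
- apply/lfunP => v; rewrite zero_lfunE -[RHS](pk (z v)).
  by elim: (k) => //= j IHj; rewrite comp_lfunE IHj.
- apply/lfunP => v; rewrite zero_lfunE -[RHS](linear0 z) -(pk v).
  by elim: (k) v => //= j IHj v; rewrite comp_lfunE IHj -iterSr.
Qed.

(** Working in [T] modulo [U] makes the adjoint action of a subalgebra [Q] on [P] modulo [Q] an
    instance of the same statement, with ['End(V)] in place of [V]; this provides the element [y]
    normalizing [Q]. *)
Lemma engel n (V : vectType F) (P : {vspace 'End(V)}) (U T : {vspace V}) :
  (\dim P <= n)%N -> lbr_closed P -> (forall p, p \in P -> lnilp p) ->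
  (forall p u, p \in P -> u \in U -> p u \in U) ->
  (forall p t, p \in P -> t \in T -> p t \in T) -> ~~ (T <= U)%VS ->
  exists v, [/\ v \in T, v \notin U & forall p, p \in P -> p v \in U].
Proof.
elim: n V P U T => [|n IHn] V P U T dimP clP nilP PU PT TU.
  have /subvPn[v vT vU] := TU; exists v; split=> // p.
  have /eqP -> : P == 0%VS by rewrite -dimv_eq0 -leqn0.
  by rewrite memv0 => /eqP->; rewrite zero_lfunE mem0v.
have [|gtP] := leqP (\dim P) n; first by move=> le; apply: IHn le clP nilP PU PT TU.
(* A subalgebra is enlarged by normalizing elements until one more line would exhaust [P]. *)
have step k (Q : {vspace 'End(V)}) : (\dim P - \dim Q <= k)%N -> lbr_closed Q ->
    (Q <= P)%VS -> (\dim Q <= n)%N ->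
    exists (Q1 : {vspace 'End(V)}) y, [/\ lbr_closed Q1, (Q1 <= P)%VS & (\dim Q1 <= n)%N] /\
      [/\ y \in P, (P <= Q1 + <[y]>)%VS & forall q, q \in Q1 -> lbr q y \in Q1].
  elim: k Q => [|k IHk] Q dimQ clQ QP le_Qn.
    by move: dimQ; rewrite leqn0 subn_eq0 => /(leq_trans gtP) /leq_trans/(_ le_Qn); rewrite ltnn.
  have [||||||y [yP yQ adQ]] := IHn _ (ad V @: Q)%VS Q P.
  - by rewrite (leq_trans _ le_Qn) // -(limg_ker_dim (ad V) Q) leq_addl.
  - move=> _ _ /memv_imgP[p pQ ->] /memv_imgP[q qQ ->].
    have -> : lbr (ad V p) (ad V q) = ad V (lbr p q).
      apply/lfunP => z; rewrite lbrE !adE; apply/lfunP => v.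
      rewrite !(lbrE, add_lfunE, opp_lfunE) !linearB /=.
      zmodule.
    by apply: memv_img; apply: clQ.
  - move=> _ /memv_imgP[p pQ ->]; apply: lnilp_ad; apply: nilP; exact: subvP QP _ pQ.
  - by move=> _ u /memv_imgP[p pQ ->] uQ; rewrite adE; apply: clQ.
  - move=> _ u /memv_imgP[p pQ ->] uP; rewrite adE; apply: clP => //; exact: subvP QP _ pQ.
  - by apply: contraL gtP => /dimvS le; rewrite -leqNgt (leq_trans le).
  have adQ' q : q \in Q -> lbr q y \in Q.
    by move=> qQ; rewrite -adE; apply/adQ/memv_img.
  pose Q' := (Q + <[y]>)%VS.
  have Q'P : (Q' <= P)%VS by rewrite subv_add QP -memvE.
  have clQ' : lbr_closed Q'.
    move=> _ _ /memv_addP[p pQ [_ /vlineP[a ->] ->]] /memv_addP[q qQ [_ /vlineP[b ->] ->]].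
    apply: (subvP (addvSl Q <[y]>)).
    rewrite addrC lbr_linl [q + _]addrC !lbr_linr.
    have -> : lbr y y = 0 by rewrite /lbr subrr.
    rewrite scaler0 add0r rpredD //; first by rewrite rpredZ // lbr_anti rpredN adQ'.
    by rewrite rpredD ?clQ // rpredZ // adQ'.
  have [PQ'|PQ'] := boolP (P <= Q')%VS; first by exists Q, y.
  have ltQ' : (\dim Q' < \dim P)%N.
    rewrite ltnNge; apply: contra PQ' => le.
    by move: (eqEdim Q' P); rewrite Q'P le => /eqP->.
  apply: (IHk Q') => //; last by rewrite -ltnS (leq_trans ltQ').
  have ltQ : (\dim Q < \dim Q')%N.
    rewrite ltnNge; apply: contra yQ => le.
    have := eqEdim Q Q'; rewrite addvSl le => /eqP->.
    by rewrite (subvP (addvSr _ _)) ?memv_line.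
  by rewrite -ltnS; apply: leq_trans (ltn_sub2l (ltn_trans ltQ ltQ') ltQ) dimQ.
have [||||Q [y [[clQ QP dimQ] [yP PQy adQ]]]] := step (\dim P) 0%VS.
- by rewrite leq_subr.
- by move=> p q; rewrite !memv0 => /eqP-> /eqP->; rewrite /lbr subrr.
- exact: sub0v.
- by rewrite dimv0.
have QPm q : q \in Q -> q \in P by apply: subvP QP q.
have [v0 [v0T v0U Qv0]] : exists v, [/\ v \in T, v \notin U & forall p, p \in Q -> p v \in U].
  by apply: IHn dimQ clQ _ _ _ TU => [p /QPm|p u /QPm|p u /QPm]; [apply: nilP|apply: PU|apply: PT].
(* [y] preserves the set of vectors that [Q] sends into [U], because [lbr q y] is again in [Q]. *)
have yv0 j : iter j y v0 \in T /\ forall q, q \in Q -> q (iter j y v0) \in U.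
  elim: j => [|j [jT jQ]] //=; split; first exact: PT.
  move=> q qQ; set w := iter j y v0 in jT jQ *.
  have -> : q (y w) = y (q w) + lbr q y w by rewrite lbrE addrC subrK.
  by apply: rpredD; [apply: PU => //; apply: jQ | apply/jQ/adQ].
have ex_j : exists j, iter j y v0 \in U.
  by have [k yk] := nilP _ yP; exists k; rewrite yk mem0v.
(* The last iterate outside [U] is the desired vector. *)
case: (ex_minnP ex_j) => -[|j] jU jmin; first by case/negP: v0U.
exists (iter j y v0); split; first by case: (yv0 j).
  by apply/negP => /jmin; rewrite ltnn.
move=> p /(subvP PQy)/memv_addP[q qQ [_ /vlineP[a ->] ->]].
by rewrite add_lfunE scale_lfunE rpredD ?rpredZ //; apply: (yv0 j).2.
Qed.

(* Engel's theorem modulo the common kernel [U] gives [v] outside [U] with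
   [P v] in [U], and then all brackets of [P] kill [v]. *)
Lemma perfect_nilpotent_eq0 (V : vectType F) (P : {vspace 'End(V)}) :
  lbr_closed P -> (forall p, p \in P -> lnilp p) ->
  (forall W : {vspace 'End(V)},
     (forall p q, p \in P -> q \in P -> lbr p q \in W) -> (P <= W)%VS) ->
  forall p, p \in P -> p = 0.
Proof.
move=> clP nilP perfP.
have [||U UE] := @subspace_of_pred F V (fun v => forall p, p \in P -> p v = 0).
- by move=> p _; rewrite linear0.
- by move=> a u v u0 v0 p pP; rewrite linearP /= u0 // v0 // scaler0 addr0.
suff fullU : (fullv <= U)%VS.
  move=> p pP; apply/lfunP => v; rewrite zero_lfunE.
  by apply: (UE v).1 pP; rewrite (subvP fullU) ?memvf.
apply/negPn/negP => nU.
have [||v [_ vU Pv]] := @engel _ V P U fullv (leqnn _) clP nilP _ _ nU.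
- by move=> p u pP /UE/(_ p pP)->; rewrite mem0v.
- by move=> *; rewrite memvf.
- move: vU => /negP; apply; apply/UE => p pP.
  have [||W WE] := @subspace_of_pred F 'End(V) (fun w => w v = 0).
  + by rewrite zero_lfunE.
  + by move=> a w w' w0 w0'; rewrite add_lfunE scale_lfunE w0 w0' scaler0 addr0.
  apply/WE; apply: (subvP (perfP W _)) pP => q r qP rP.
  by apply/WE; rewrite lbrE ((UE _).1 (Pv r rP)) // ((UE _).1 (Pv q qP)) // subrr.
Qed.


(** * Traces of endomorphisms and Cartan's criterion for perfect algebras *)

Definition lftrace (V : vectType F) (f : 'End(V)) : F := \tr (f2mx f).

Lemma f2mx_v2r (V W : vectType F) (f : 'Hom(V, W)) v :
  v2r (f v) = v2r v *m f2mx f.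
Proof. by rewrite unlock /= r2vK. Qed.

Lemma f2mx_eq (V W : vectType F) (f : 'Hom(V, W)) A :
  (forall v, v2r (f v) = v2r v *m A) -> f2mx f = A.
Proof.
move=> fA; apply/row_matrixP => i; rewrite !rowE -[delta_mx 0 i]r2vK.
by rewrite -f2mx_v2r fA.
Qed.

Lemma f2mx_comp (V : vectType F) (f g : 'End(V)) :
  f2mx (f \o g)%VF = f2mx g *m f2mx f.
Proof. by apply: f2mx_eq => v; rewrite comp_lfunE !f2mx_v2r mulmxA. Qed.

Lemma f2mx_linear (V : vectType F) a (f g : 'End(V)) :
  f2mx (a *: f + g) = a *: f2mx f + f2mx g.
Proof.
apply: f2mx_eq => v; rewrite add_lfunE scale_lfunE linearP /= !f2mx_v2r.
by rewrite mulmxDr scalemxAr.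
Qed.

HB.instance Definition _ (V : vectType F) :=
  GRing.isLinear.Build F 'End(V) _ _ (@f2mx _ V V) (@f2mx_linear V).

Lemma lftrace_linear (V : vectType F) a (f g : 'End(V)) :
  lftrace (a *: f + g) = a * lftrace f + lftrace g.
Proof. by rewrite /lftrace f2mx_linear linearP. Qed.

Lemma lftraceB (V : vectType F) (f g : 'End(V)) :
  lftrace (f - g) = lftrace f - lftrace g.
Proof. by rewrite /lftrace !linearB. Qed.

Lemma lftraceC (V : vectType F) (f g : 'End(V)) :
  lftrace (f \o g)%VF = lftrace (g \o f)%VF.
Proof. by rewrite /lftrace !f2mx_comp mxtrace_mulC. Qed.

Lemma lftrace_nilpotent (V : vectType F) (f : 'End(V)) : lnilp f -> lftrace f = 0.
Proof.
case=> k fk; apply: (@mxtrace_nilpotent _ _ _ k).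
apply/row_matrixP => i; rewrite row0 rowE -[delta_mx 0 i]r2vK.
rewrite -[RHS](linear0 v2r) -(fk (r2v (delta_mx 0 i))).
elim: k {fk} (r2v _) => [|k IHk] v /=; first by rewrite mulmx1.
by rewrite mulmxA -f2mx_v2r IHk -iterSr.
Qed.

(** Perfectness serves twice: it writes each element as a combination of brackets, which the trace
    criterion for nilpotency requires, and it turns nilpotency into vanishing. *)
Lemma perfect_trace_zero (charF : [pchar F] =i pred0) (V : vectType F)
    (P : {vspace 'End(V)}) :
  lbr_closed P ->
  (forall W : {vspace 'End(V)},
     (forall p q, p \in P -> q \in P -> lbr p q \in W) -> (P <= W)%VS) ->
  (forall p q, p \in P -> q \in P -> lftrace (p \o q)%VF = 0) ->
  forall p, p \in P -> p = 0.
Proof.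
move=> clP perfP trP; apply: perfect_nilpotent_eq0 => // p pP.
set b := vbasis P.
have bP i : b`_i \in P.
  have [lt|le] := ltnP i (\dim P); last by rewrite nth_default ?mem0v ?size_tuple.
  by apply/vbasis_mem/mem_nth; rewrite size_tuple.
have coordP q : q \in P -> q = \sum_i coord b i q *: b`_i.
  by move=> qP; apply: coord_vbasis.
have f2lbr (q r : 'End(V)) : f2mx (lbr q r) = f2mx r *m f2mx q - f2mx q *m f2mx r.
  by rewrite /lbr linearB /= !f2mx_comp.
exists (dim V) => v; apply: (can_inj v2rK).
have iE k w : v2r (iter k p w) = v2r w *m iter k (mulmx (f2mx p)) 1%:M.
  elim: k w => [|k IHk] w; first by rewrite mulmx1.
  by rewrite iterSr IHk f2mx_v2r /= -mulmxA.
rewrite iE (@trace_form_zero_nilpotent F charF _ (\dim P) (fun i => f2mx b`_i)).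
- by rewrite mulmx0 linear0.
(* The indices are exchanged because [f2mx] acts on row vectors and so reverses composition. *)
- move=> i j; exists (fun l => coord b l (lbr b`_j b`_i)).
  rewrite -f2lbr {1}(coordP (lbr b`_j b`_i)) ?clP // linear_sum.
  by apply: eq_bigr => l _; rewrite linearZ.
- by move=> i j; rewrite -f2mx_comp; apply: trP.
- exists (fun l => coord b l p); rewrite {1}(coordP p pP) linear_sum.
  by apply: eq_bigr => l _; rewrite linearZ.
have [||W WE] := @subspace_of_pred F 'End(V) (fun q => exists c : 'I_(\dim P) -> 'I_(\dim P) -> F,
  q = \sum_i \sum_j c i j *: lbr b`_j b`_i).
- by exists (fun _ _ => 0); rewrite big1 // => i _; rewrite big1 // => j _; rewrite scale0r.
- move=> a _ _ [c ->] [d ->]; exists (fun i j => a * c i j + d i j).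
  rewrite scaler_sumr -big_split; apply: eq_bigr => i _ /=.
  rewrite scaler_sumr -big_split; apply: eq_bigr => j _ /=.
  by rewrite scalerDl scalerA.
have [c ->] : exists c : 'I_(\dim P) -> 'I_(\dim P) -> F,
    p = \sum_i \sum_j c i j *: lbr b`_j b`_i.
  apply/WE; apply: (subvP (perfP W _)) pP => q r qP rP.
  apply/WE; exists (fun i j => coord b i r * coord b j q).
  have lin1 s : lbr s r = \sum_i coord b i r *: lbr s b`_i.
    rewrite -adE {1}(coordP r rP) linear_sum; apply: eq_bigr => i _.
    by rewrite linearZ /= adE.
  rewrite lin1; apply: eq_bigr => i _; rewrite -adE {1}(coordP q qP).
  rewrite linear_sum sum_lfunE scaler_sumr; apply: eq_bigr => j _.
  by rewrite linearZ /= scale_lfunE scalerA adE.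
exists c; rewrite linear_sum; apply: eq_bigr => i _; rewrite linear_sum.
by apply: eq_bigr => j _; rewrite linearZ /= f2lbr.
Qed.

End Engel.

(** * Semi-simple Leibniz algebras *)

Lemma vspace_chain_stable (F : fieldType) (V : vectType F) (s : nat -> {vspace V}) :
  (forall k, (s k.+1 <= s k)%VS) -> exists k, s k.+1 = s k.
Proof.
move=> dec; apply: NNPP => no.
have lt k : (\dim (s k) + k <= \dim (s 0))%N.
  elim: k => [|k IHk]; first by rewrite addn0.
  apply: leq_trans IHk; rewrite addnS ltn_add2r.
  rewrite ltnNge; apply/negP => le; apply: no; exists k; apply/eqP.
  by rewrite eqEdim dec.
have := lt (\dim (s 0)).+1; rewrite leqNgt => /negP; apply.
by rewrite addnS ltnS leq_addl.
Qed.

Section Leibniz.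
Variables (F : fieldType) (charF : [pchar F] =i pred0).
Variables (L : vectType F) (mul : L -> L -> L).
Hypotheses (hL : leibniz_algebra mul) (hss : semisimple mul).

Definition lmult : 'Hom(L, 'End(L)) := linfun (fun x => linfun (mul x)).

Lemma lmultE x y : lmult x y = mul x y.
Proof.
have [linl linr _] := hL.
have E u : linfun (mul u) =1 mul u by apply: linfun_linE => a v w; apply: linr.
rewrite /lmult linfun_linE => [|a u v]; first exact: E.
by apply/lfunP => w; rewrite add_lfunE scale_lfunE !E linl.
Qed.

Definition rep (V : vectType F) (rho : 'Hom(L, 'End(V))) : Prop :=
  forall x y, rho (mul x y) = lbr (rho x) (rho y).

Lemma rep_lmult : rep lmult.
Proof.
have [_ _ leibid] := hL.
by move=> x y; apply/lfunP => z; rewrite lbrE !lmultE leibid addrK.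
Qed.

Lemma rep_leib (V : vectType F) (rho : 'Hom(L, 'End(V))) v :
  rep rho -> leib mul v -> rho v = 0.
Proof.
move=> hrho [s ->]; rewrite linear_sum big1 // => p _.
by rewrite linearZ /= hrho /lbr subrr scaler0.
Qed.

Lemma rep_anti (V : vectType F) (rho : 'Hom(L, 'End(V))) x y :
  rep rho -> rho (mul x y) = - rho (mul y x).
Proof. by move=> hrho; rewrite !hrho lbr_anti. Qed.

(** * Ideals and their derived series *)

Definition mulv (U : {vspace L}) : {vspace L} :=
  <<[seq mul x y | x <- vbasis U, y <- vbasis U]>>%VS.

Lemma memv_mulv (U : {vspace L}) x y : x \in U -> y \in U -> mul x y \in mulv U.
Proof.
move=> xU yU; rewrite -lmultE (coord_vbasis xU) linear_sum sum_lfunE.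
apply: rpred_sum => i _; rewrite linearZ scale_lfunE rpredZ //=.
rewrite (coord_vbasis yU) linear_sum; apply: rpred_sum => j _.
rewrite linearZ rpredZ //= lmultE; apply: memv_span; apply: allpairs_f;
  by rewrite mem_nth // size_tuple.
Qed.

Lemma mulv_sub (U W : {vspace L}) :
  (forall x y, x \in U -> y \in U -> mul x y \in W) -> (mulv U <= W)%VS.
Proof.
move=> UW; apply/span_subvP => _ /allpairsP[[x y] [/= xU yU ->]].
by apply: UW; apply: vbasis_mem.
Qed.

Lemma mulv_mono (U W : {vspace L}) : (U <= W)%VS -> (mulv U <= mulv W)%VS.
Proof. by move=> /subvP UW; apply: mulv_sub => x y /UW xW /UW; apply: memv_mulv. Qed.

Definition ideal (J : {vspace L}) : Prop :=
  forall x y, y \in J -> mul x y \in J /\ mul y x \in J.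

Lemma ideal_mulv_sub J : ideal J -> (mulv J <= J)%VS.
Proof. by move=> iJ; apply: mulv_sub => x y _ /(iJ x)[]. Qed.

Lemma ideal_mulv J : ideal J -> ideal (mulv J).
Proof.
move=> iJ; have [linl _ leibid] := hL.
have assoc x y z : mul (mul x y) z = mul x (mul y z) - mul y (mul x z).
  by rewrite leibid addrK.
move=> x y yJ; split.
  rewrite -lmultE memv_preim; apply: (subvP (mulv_sub _)) yJ => u v uJ vJ.
  rewrite -memv_preim lmultE leibid.
  by apply: rpredD; apply: memv_mulv => //; [case: (iJ x u uJ) | case: (iJ x v vJ)].
pose r := linfun (fun w => mul w x).
have rE : r =1 (fun w => mul w x) by apply: linfun_linE => a u v; apply: linl.
rewrite -rE memv_preim; apply: (subvP (mulv_sub _)) yJ => u v uJ vJ.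
rewrite -memv_preim rE assoc.
by apply: rpredB; apply: memv_mulv => //; [case: (iJ x v vJ) | case: (iJ x u uJ)].
Qed.

Lemma ideal_capv J J' : ideal J -> ideal J' -> ideal (J :&: J')%VS.
Proof.
move=> iJ iJ' x y; rewrite !memv_cap => /andP[/(iJ x)[-> ->] /(iJ' x)[-> ->]].
by [].
Qed.

Lemma ideal_perfect_limit J : ideal J -> exists k,
  let P := iter k mulv J in [/\ ideal P, (P <= J)%VS & mulv P = P].
Proof.
move=> iJ; have iJk k : ideal (iter k mulv J).
  by elim: k => //= k; apply: ideal_mulv.
have dec k : (iter k.+1 mulv J <= iter k mulv J)%VS by apply: ideal_mulv_sub; apply: iJk.
have [k kE] := vspace_chain_stable dec.
exists k; split=> //; elim: (k) => //= j; exact: subv_trans (dec j).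
Qed.

(** The derived series of [J] ends in a perfect ideal inside [J], which must be 0; so [J] is
    solvable and semi-simplicity applies. *)
Lemma ideal_sub_leib J : ideal J ->
  (forall Q, ideal Q -> (Q <= J)%VS -> mulv Q = Q -> Q = 0%VS) ->
  forall v, v \in J -> leib mul v.
Proof.
move=> iJ noQ; apply: (hss (I := fun v => v \in J)).
  by split=> [|a u v uJ vJ|]; rewrite ?mem0v // rpredD ?rpredZ.
have [k [iP PJ PP]] := ideal_perfect_limit iJ.
exists k => v vk; apply/eqP; rewrite -memv0 -(noQ _ iP PJ PP).
elim: (k) v vk => //= j IHj _ [s [sP ->]].
rewrite big_seq; apply: rpred_sum => p ps; rewrite rpredZ //.
by have [p1 p2] := sP p ps; apply: memv_mulv; apply: IHj.
Qed.

(** * Trace forms and their radicals *)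

Definition trf (V : vectType F) (rho : 'Hom(L, 'End(V))) (x y : L) : F :=
  lftrace (rho x \o rho y)%VF.

Lemma trfC (V : vectType F) (rho : 'Hom(L, 'End(V))) x y :
  trf rho x y = trf rho y x.
Proof. exact: lftraceC. Qed.

Lemma trf_linl (V : vectType F) (rho : 'Hom(L, 'End(V))) a x x' y :
  trf rho (a *: x + x') y = a * trf rho x y + trf rho x' y.
Proof.
by rewrite /trf linearP /= comp_lfunDl -comp_lfunZl lftrace_linear.
Qed.

Lemma trf_inv (V : vectType F) (rho : 'Hom(L, 'End(V))) x y z :
  rep rho -> trf rho (mul x y) z = trf rho x (mul y z).
Proof.
move=> hrho; rewrite /trf !hrho /lbr comp_lfunDl comp_lfunDr comp_lfunNl comp_lfunNr.
rewrite !lftraceB !comp_lfunA; congr (_ - _).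
by rewrite -(comp_lfunA (rho y)) lftraceC.
Qed.

Lemma perfect_trf_zero (V : vectType F) (rho : 'Hom(L, 'End(V))) (P : {vspace L}) :
  rep rho -> mulv P = P ->
  (forall p q, p \in P -> q \in P -> trf rho p q = 0) ->
  forall p, p \in P -> rho p = 0.
Proof.
move=> hrho PP trP p pP.
apply: (@perfect_trace_zero F charF V (rho @: P)%VS); last exact: memv_img.
- move=> _ _ /memv_imgP[u uP ->] /memv_imgP[v vP ->].
  by rewrite -hrho; apply: memv_img; rewrite -PP; apply: memv_mulv.
- move=> W WP; apply/subvP => _ /memv_imgP[u uP ->].
  rewrite memv_preim; rewrite -PP in uP; apply: (subvP (mulv_sub _)) uP => x y xP yP.
  by rewrite -memv_preim hrho; apply: WP; apply: memv_img.
- by move=> _ _ /memv_imgP[u uP ->] /memv_imgP[v vP ->]; apply: trP.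
Qed.

Lemma trf_orth (V : vectType F) (rho : 'Hom(L, 'End(V))) (P : {vspace L}) :
  exists O : {vspace L}, forall x, x \in O <-> forall p, p \in P -> trf rho x p = 0.
Proof.
apply: subspace_of_pred => [p _|a u v u0 v0 p pP].
  by rewrite /trf linear0 comp_lfun0l /lftrace linear0 mxtrace0.
by rewrite trf_linl u0 // v0 // mulr0 addr0.
Qed.

(** Invariance of the form treats [mul y x]; for [mul x y] it is enough that [rho] cannot tell it
    from [- mul y x]. *)
Lemma ideal_orth (V : vectType F) (rho : 'Hom(L, 'End(V))) (P O : {vspace L}) :
  rep rho -> ideal P ->
  (forall x, x \in O <-> forall p, p \in P -> trf rho x p = 0) -> ideal O.
Proof.
move=> hrho iP OE x y /OE yO.
have yx p : p \in P -> trf rho (mul y x) p = 0.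
  by move=> pP; rewrite trf_inv // yO //; case: (iP x p pP).
split; apply/OE => p pP; last exact: yx.
by rewrite /trf rep_anti // comp_lfunNl /lftrace linearN linearN /= [X in - X]yx ?oppr0.
Qed.

Lemma form_suml (B : L -> L -> F) :
  (forall a x x' y, B (a *: x + x') y = a * B x y + B x' y) ->
  forall I (r : seq I) (c : I -> F) (v : I -> L) y,
    B (\sum_(i <- r) c i *: v i) y = \sum_(i <- r) c i * B (v i) y.
Proof.
move=> Bl I r c v y; elim: r => [|i r IHr]; last by rewrite !big_cons Bl IHr.
by rewrite !big_nil; move: (Bl (-1) 0 0 y); rewrite scaler0 addr0 mulN1r addNr.
Qed.

(* Solves for the coordinates of [p] in a linear system whose matrix is the Gram
   matrix of [P]; the hypothesis on the radical makes it consistent. *)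
Lemma orth_decomp (B : L -> L -> F) (P : {vspace L}) :
  (forall a x x' y, B (a *: x + x') y = a * B x y + B x' y) ->
  (forall x y, B x y = B y x) ->
  (forall v, v \in P -> (forall p, p \in P -> B v p = 0) -> forall x, B x v = 0) ->
  forall x, exists2 p, p \in P & forall q, q \in P -> B (x - p) q = 0.
Proof.
move=> Bl BC Brad x; set b := vbasis P.
have bP (i : 'I_(\dim P)) : b`_i \in P by rewrite vbasis_mem // mem_nth // size_tuple.
have Bsum := form_suml Bl.
pose A := \matrix_(i < \dim P, j < \dim P) B b`_i b`_j.
pose w := \row_(j < \dim P) B x b`_j.
have /submxP[c cE] : (w <= A)%MS.
  rewrite submxE; apply/eqP/rowP => l.
  move: (mulmx_coker A); move: (cokermx A) => U AU; rewrite !mxE.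
  pose v := \sum_(j < \dim P) U j l *: b`_j.
  have vP : v \in P by apply: rpred_sum => j _; rewrite rpredZ.
  have Bv : forall p, p \in P -> B v p = 0.
    move=> p pP; rewrite BC (coord_vbasis pP) Bsum big1 // => i _.
    rewrite BC Bsum; apply/eqP; rewrite mulf_eq0; apply/orP; right; apply/eqP.
    have := congr1 (fun M : 'M_(_) => M i l) AU; rewrite !mxE => AU0; rewrite -[RHS]AU0.
    by apply: eq_bigr => j _; rewrite !mxE mulrC BC.
  rewrite -[RHS](Brad v vP Bv x) BC Bsum; apply: eq_bigr => j _.
  by rewrite !mxE mulrC BC.
exists (\sum_(i < \dim P) c 0 i *: b`_i).
  by apply: rpred_sum => i _; rewrite rpredZ.
move=> q qP; rewrite BC (coord_vbasis qP) Bsum big1 // => j _.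
rewrite BC addrC -scaleN1r Bl mulN1r Bsum.
have -> : B x b`_j = \sum_(i < \dim P) c 0 i * B b`_i b`_j.
  have := congr1 (fun M : 'rV_(_) => M 0 j) cE; rewrite !mxE => ->.
  by apply: eq_bigr => i _; rewrite mxE.
by rewrite addNr mulr0.
Qed.

(* [P] is the limit of the derived series of [R], and [x - p] is taken orthogonal
   to [P] for the Killing form; perfect ideals in [P] or [R] orthogonal to [P]
   vanish by Cartan's criterion. *)
Lemma ideal_decomp R : ideal R -> exists P,
  [/\ mulv P = P, (P <= R)%VS & forall x, x \in R -> exists2 p, p \in P & leib mul (x - p)].
Proof.
move=> iR; have [k [iP PR PP]] := ideal_perfect_limit iR.
set P := iter k mulv R in iP PR PP; exists P; split=> //.
have [O OE] := trf_orth lmult P.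
have iO := ideal_orth rep_lmult iP OE.
have PO0 Q : (Q <= P)%VS -> (Q <= O)%VS -> mulv Q = Q -> Q = 0%VS.
  move=> /subvP QP /subvP QO QQ; apply/eqP; rewrite -subv0 -QQ.
  apply: mulv_sub => x y xQ yQ; rewrite -lmultE.
  rewrite (perfect_trf_zero rep_lmult QQ _ xQ) ?zero_lfunE ?mem0v // => p q pQ qQ.
  by apply: (OE p).1; [apply: QO | apply: QP].
(* The radical of the Killing form on [P] contains no nonzero perfect ideal, so it lies in the
   Leibniz kernel and acts by 0. This is the condition that [orth_decomp] needs. *)
have POleib v : v \in P -> (forall p, p \in P -> trf lmult v p = 0) ->
    forall x, trf lmult x v = 0.
  move=> vP /OE vO x; rewrite /trf.
  have -> : lmult v = 0.
    apply: rep_leib rep_lmult _; apply: (@ideal_sub_leib (P :&: O)%VS).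
    - exact: ideal_capv.
    - by move=> Q _; rewrite subv_cap => /andP[QP QO] QQ; apply: PO0.
    - by rewrite memv_cap vP.
  by rewrite comp_lfun0r /lftrace linear0 mxtrace0.
move=> x xR.
have [p pP xp] := orth_decomp (@trf_linl _ lmult) (@trfC _ lmult) POleib x.
exists p => //; apply: (@ideal_sub_leib (R :&: O)%VS).
- exact: ideal_capv.
(* A perfect ideal inside [R] lies in every derived term of [R], hence in [P]. *)
- move=> Q _; rewrite subv_cap => /andP[QR QO] QQ; apply: PO0 => //.
  rewrite /P; elim: (k) => //= j IHj; rewrite -QQ; exact: mulv_mono.
- by rewrite memv_cap rpredB ?(subvP PR p) //=; apply/OE.
Qed.

(** Every element of L is a sum of one in a perfect [P] and one in the Leibniz kernel, which is
    spanned by squares; both are combinations of products. *)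
Lemma semisimple_perfect (W : {vspace L}) :
  (forall x y, mul x y \in W) -> forall x, x \in W.
Proof.
move=> mW x; have [|P [PP _ PL]] := @ideal_decomp fullv.
  by move=> y z _; rewrite !memvf.
have [p pP [s sE]] := PL x (memvf x); rewrite -[x](subrK p) rpredD //.
  by rewrite sE; apply: rpred_sum => q _; rewrite rpredZ.
by rewrite -PP in pP; apply: (subvP (mulv_sub _)) pP.
Qed.

(** The radical is an ideal, so each of its elements lies in a perfect [P] up to the Leibniz kernel.
    Cartan's criterion makes [P] act by 0, and the kernel always does. *)
Lemma trf_radical (V : vectType F) (rho : 'Hom(L, 'End(V))) x :
  rep rho -> (forall y, trf rho x y = 0) -> rho x = 0.
Proof.
move=> hrho x0; have [R RE] := trf_orth rho fullv.
have iR : ideal R by apply: (ideal_orth hrho _ RE) => y z _; rewrite !memvf.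
have [P [PP /subvP PR Pleib]] := ideal_decomp iR.
have [|p pP xp] := Pleib x; first by apply/RE => p _.
rewrite -[x](subrK p) linearD /= (rep_leib hrho xp) add0r.
by apply: (perfect_trf_zero hrho PP) pP => q r /PR/RE qR _; apply: qR; apply: memvf.
Qed.

(** The radical [R] of the trace form acts by 0, so the form is nondegenerate on any vector space
    complement [C], and [c] is its Casimir operator. The trace of [c] is [\dim C], nonzero in
    characteristic zero. As [V] is not assumed simple, non-nilpotency replaces invertibility. *)
Lemma casimir (V : vectType F) (rho : 'Hom(L, 'End(V))) :
  rep rho -> rho != 0 -> exists c : 'End(V),
    [/\ forall x v, rho x (c v) = c (rho x v),
        forall (K : {vspace V}) v, (forall x u, u \in K -> rho x u \in K) ->
          (forall x, rho x v \in K) -> c v \in K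
      & ~ lnilp c].
Proof.
move=> hrho rho0; have [R RE] := trf_orth rho fullv.
have Rrho x : x \in R -> rho x = 0.
  by move=> /RE xR; apply: trf_radical => // y; apply: xR; apply: memvf.
set C := (R^C)%VS; set r := \dim C; pose b (i : 'I_r) := (vbasis C)`_i.
have bC i : b i \in C by rewrite vbasis_mem // mem_nth // size_tuple.
have decomp x : exists a : 'I_r -> F, rho x = \sum_k a k *: rho (b k).
  have : x \in (R + C)%VS by rewrite addv_complf memvf.
  case/memv_addP=> u uR [t tC ->]; exists (fun k => coord (vbasis C) k t).
  rewrite linearD /= Rrho // add0r {1}(coord_vbasis tC) linear_sum.
  by apply: eq_bigr => k _; rewrite linearZ.
have r_gt0 : (0 < r)%N.
  rewrite lt0n dimv_eq0; apply: contraNneq rho0 => C0.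
  apply/eqP/lfunP => x; rewrite zero_lfunE Rrho //.
  by have := addv_complf R; rewrite -/C C0 addv0 => ->; apply: memvf.
pose G := \matrix_(i < r, j < r) trf rho (b i) (b j).
have Gsym : G^T = G by apply/matrixP => i j; rewrite !mxE trfC.
have trf_rho x (a : 'I_r -> F) y : rho x = \sum_k a k *: rho (b k) ->
    trf rho x y = \sum_k a k * trf rho (b k) y.
  move=> xE; rewrite -(form_suml (@trf_linl _ rho)) /trf xE linear_sum.
  by under [in RHS]eq_bigr do rewrite linearZ.
have uG : G \in unitmx.
  rewrite -row_free_unit -kermx_eq0; apply/rowV0P => u /sub_kermxP uG.
  pose v := \sum_i u 0 i *: b i.
  have vC : v \in C by apply: rpred_sum => i _; rewrite rpredZ.
  have vR : v \in R.
    apply/RE => y _; have [a aE] := decomp y.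
    rewrite trfC (trf_rho _ _ _ aE) big1 // => k _; rewrite trfC.
    rewrite (form_suml (@trf_linl _ rho)); apply/eqP; rewrite mulf_eq0; apply/orP; right.
    have := congr1 (fun M : 'rV_r => M 0 k) uG; rewrite !mxE => {}uG.
    by apply/eqP; rewrite -[RHS]uG; apply: eq_bigr => i _; rewrite !mxE.
  have v0 : v = 0 by apply/eqP; rewrite -memv0 -(capv_compl R) memv_cap vR.
  apply/rowP => i; rewrite mxE.
  by rewrite -(coord_sum_free (u 0) i (basis_free (vbasisP C))) -/v v0 linear0.
pose H := invmx G.
pose c : 'End(V) := \sum_i \sum_j H i j *: (rho (b i) \o rho (b j))%VF.
have cE v : c v = \sum_i \sum_j H i j *: rho (b i) (rho (b j) v).
  rewrite /c sum_lfunE; apply: eq_bigr => i _; rewrite sum_lfunE.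
  by apply: eq_bigr => j _; rewrite scale_lfunE comp_lfunE.
exists c; split.
- move=> x v; apply/eqP; rewrite -subr_eq0; apply/eqP.
  have [a aE] : exists a : 'I_r -> 'I_r -> F,
      forall i, rho (mul x (b i)) = \sum_k a i k *: rho (b k).
    exact: fin_all_exists (fun i => decomp (mul x (b i))).
  pose A := \matrix_(i, k) a i k.
  (* Invariance of the form; [A] is the matrix of left multiplication by [x] on [C], modulo elements
     acting by 0. *)
  have AG : A *m G + G *m A^T = 0.
    apply/matrixP => i j; rewrite !mxE.
    have -> : \sum_k A i k * G k j = trf rho (mul x (b i)) (b j).
      by rewrite (trf_rho _ _ _ (aE i)); apply: eq_bigr => k _; rewrite !mxE.
    have -> : \sum_k G i k * A^T k j = trf rho (b i) (mul x (b j)).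
      rewrite trfC (trf_rho _ _ _ (aE j)); apply: eq_bigr => k _.
      by rewrite !mxE mulrC trfC.
    rewrite -trf_inv // /trf (rep_anti (b i)) // comp_lfunNl.
    by rewrite /lftrace linearN linearN /= subrr.
  (* Multiplying by the inverse Gram matrix on both sides turns invariance into the relation that
     cancels the commutator of [rho x] and [c]. *)
  have HA : H *m A + A^T *m H = 0.
    have := congr1 (fun M => H *m M *m H) AG.
    rewrite mulmxDr mulmxDl mulmx0 mul0mx -!mulmxA mulmxV // mulmx1.
    by rewrite (mulmxA H G) mulVmx // mul1mx.
  have aEv i w : rho x (rho (b i) w) = \sum_k a i k *: rho (b k) w + rho (b i) (rho x w).
    have -> : \sum_k a i k *: rho (b k) w = rho (mul x (b i)) w.
      by rewrite aE sum_lfunE; apply: eq_bigr => k _; rewrite scale_lfunE.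
    by rewrite hrho lbrE subrK.
  pose f k l := rho (b k) (rho (b l) v).
  have -> : rho x (c v) - c (rho x v) =
      \sum_i \sum_j \sum_k (H i j * a i k) *: f k j
      + \sum_i \sum_j \sum_k (H i j * a j k) *: f i k.
    rewrite !cE linear_sum -sumrB -big_split; apply: eq_bigr => i _ /=.
    rewrite linear_sum -sumrB -big_split; apply: eq_bigr => j _ /=.
    rewrite linearZ /= aEv aEv [rho (b i) (_ + _)]linearD /= linear_sum /=.
    rewrite -scalerBr addrA addrK.
    rewrite scalerDr !scaler_sumr; congr (_ + _); apply: eq_bigr => k _.
      by rewrite scalerA.
    by rewrite linearZ scalerA.
  have -> : \sum_i \sum_j \sum_k (H i j * a i k) *: f k j
      = \sum_k \sum_j (A^T *m H) k j *: f k j.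
    rewrite [LHS]exchange_big [RHS]exchange_big /=; apply: eq_bigr => j _.
    rewrite [LHS]exchange_big /=; apply: eq_bigr => k _.
    by rewrite mxE scaler_suml; apply: eq_bigr => i _; rewrite !mxE mulrC.
  have -> : \sum_i \sum_j \sum_k (H i j * a j k) *: f i k
      = \sum_i \sum_k (H *m A) i k *: f i k.
    apply: eq_bigr => i _; rewrite exchange_big; apply: eq_bigr => k _.
    by rewrite mxE scaler_suml; apply: eq_bigr => j _; rewrite !mxE.
  rewrite -big_split big1 // => i _; rewrite -big_split big1 // => k _ /=.
  have := congr1 (fun M : 'M_r => M i k) HA; rewrite !mxE addrC => HAik.
  by rewrite -scalerDl HAik scale0r.
- move=> K v KL Kv; rewrite cE; apply: rpred_sum => i _; apply: rpred_sum => j _.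
  by rewrite rpredZ // KL.
- move=> /lftrace_nilpotent; rewrite /c /lftrace linear_sum linear_sum /=.
  under eq_bigr => i _ do (rewrite linear_sum linear_sum /=;
    under eq_bigr => j _ do rewrite linearZ linearZ /= -[\tr _]/(trf rho (b i) (b j))).
  move=> trc; have : \tr (H *m G) = 0.
    rewrite -[RHS]trc; apply: eq_bigr => i _; rewrite mxE; apply: eq_bigr => j _.
    by rewrite mxE trfC.
  rewrite mulVmx // mxtrace1 => /eqP; rewrite ((pcharf0P F).1 charF).
  by rewrite eqn0Ngt r_gt0.
Qed.

(* For the Casimir operator [c], the images [c^j K] stabilize, so [c^(j+1) f] lies
   in [c^(j+1) K]; this moves [f] into the proper submodule [ker c^(j+1)]. *)
Lemma invariant_complement n (V : vectType F) (rho : 'Hom(L, 'End(V)))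
    (K : {vspace V}) f :
  (\dim {:V} <= n)%N -> rep rho -> (forall x u, u \in K -> rho x u \in K) ->
  (forall x, rho x f \in K) ->
  exists2 k, k \in K & forall x, rho x (f - k) = 0.
Proof.
elim: n V rho K f => [|n IHn] V rho K f dimV hrho KL Kf.
  exists 0 => [|x]; first exact: mem0v.
  apply/eqP; rewrite -memv0.
  have -> : 0%VS = fullv :> {vspace V} by apply/esym/eqP; rewrite -dimv_eq0 -leqn0.
  exact: memvf.
have [rho0|rho_n0] := eqVneq rho 0.
  by exists 0 => [|x]; [apply: mem0v | rewrite rho0 !zero_lfunE].
have [c [cL cK cnil]] := casimir hrho rho_n0.
have cKK u : u \in K -> c u \in K by move=> uK; apply: cK => // x; apply: KL.
pose s j := iter j (fun W => (c @: W)%VS) K.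
have sP j v : v \in s j <-> exists2 k, k \in K & v = iter j c k.
  elim: j v => [|j IHj] v /=; first by split=> [vK|[k kK ->]] //; exists v.
  split=> [/memv_imgP[w /IHj[k kK ->] ->]|[k kK ->]]; first by exists k.
  by apply: memv_img; apply/IHj; exists k.
have [|j sj] := @vspace_chain_stable F V s.
  move=> j; apply/subvP => _ /sP[k kK ->]; apply/sP; exists (c k); first exact: cKK.
  by rewrite iterSr.
have [k kK kE] : exists2 k, k \in K & iter j.+1 c f = iter j.+1 c k.
  apply/sP; rewrite sj; apply/sP; exists (c f); first exact: cK.
  by rewrite iterSr.
have iterB i u v : iter i c (u - v) = iter i c u - iter i c v.
  by elim: i => //= i ->; rewrite linearB.
have iterL i x v : rho x (iter i c v) = iter i c (rho x v).
  by elim: i => //= i IHi; rewrite cL IHi.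
have [||U UE] := @subspace_of_pred F V (fun v => iter j.+1 c v = 0).
- by elim: (j.+1) => //= i ->; rewrite linear0.
- move=> a u v u0 v0.
  have -> : iter j.+1 c (a *: u + v) = a *: iter j.+1 c u + iter j.+1 c v.
    by elim: (j.+1) => //= i ->; rewrite linearP.
  by rewrite u0 v0 scaler0 addr0.
have UL x u : u \in U -> rho x u \in U.
  by move=> /UE u0; apply/UE; rewrite -iterL u0 linear0.
have ltU : (\dim U < \dim {:V})%N.
  rewrite ltnNge; apply/negP => le; apply: cnil; exists j.+1 => v; apply/UE.
  have /eqP -> : U == fullv by rewrite eqEdim subvf.
  exact: memvf.
pose rx x := linfun (fun u : subvs_of U => vsproj U (rho x (vsval u))).
have rxE x u : vsval (rx x u) = rho x (vsval u).
  rewrite /rx linfun_linE => [|a v w]; first by rewrite vsprojK // UL // subvsP.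
  by rewrite !linearP.
pose rho' : 'Hom(L, 'End(subvs_of U)) := linfun rx.
have rho'E x u : vsval (rho' x u) = rho x (vsval u).
  rewrite /rho' linfun_linE => [|a y z]; first exact: rxE.
  apply/lfunP => w; apply: val_inj => /=.
  by rewrite rxE !(add_lfunE, scale_lfunE) linearP linearP /= add_lfunE scale_lfunE !rxE.
have fU : f - k \in U by apply/UE; rewrite iterB kE subrr.
have [K' K'E] := @subspace_of_pred F (subvs_of U) (fun u => vsval u \in K)
  (mem0v K) (fun a u v uK vK => rpredD (rpredZ a uK) vK).
have [|||x|k' k'K k'E] := IHn (subvs_of U) rho' K' (vsproj U (f - k)).
- by rewrite dimvf -ltnS (leq_trans ltU).
- move=> x y; apply/lfunP => u; apply: val_inj => /=.
  by rewrite rho'E hrho !lbrE linearB /= !rho'E.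
- by move=> x u /K'E uK; apply/K'E; rewrite rho'E KL.
- by apply/K'E; rewrite rho'E vsprojK // linearB /= rpredB // KL.
exists (k + vsval k') => [|x]; first by rewrite rpredD //; apply/K'E.
rewrite opprD addrA -[f - k](vsprojK fU) -linearB -rho'E k'E.
by rewrite linear0.
Qed.

End Leibniz.

(** * Leibniz cohomology *)

Section Cohomology.
Variables (F : fieldType) (charF : [pchar F] =i pred0).
Variables (L : vectType F) (mul : L -> L -> L).
Hypotheses (hL : leibniz_algebra mul) (hss : semisimple mul).
Variables (M : vectType F) (lact : L -> M -> M) (ract : M -> L -> M).
Hypothesis hM : bimodule mul lact ract.

Let lact_linl a x y m : lact (a *: x + y) m = a *: lact x m + lact y m.
Proof. by case: hM. Qed.
Let lact_linr a x m n : lact x (a *: m + n) = a *: lact x m + lact x n.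
Proof. by case: hM => _ []. Qed.
Let ract_linr a x y m : ract m (a *: x + y) = a *: ract m x + ract m y.
Proof. by case: hM => _ [_ []]. Qed.
Let ract_linl a x m n : ract (a *: m + n) x = a *: ract m x + ract n x.
Proof. by case: hM => _ [_ [_ []]]. Qed.
Let lact_mul x y m : lact (mul x y) m = lact x (lact y m) - lact y (lact x m).
Proof. by case: hM => _ [_ [_ [_ []]]]. Qed.
Let ract_lact x y m : ract (lact x m) y = lact x (ract m y) - ract m (mul x y).
Proof. by case: hM => _ [_ [_ [_ [_ []]]]]. Qed.
Let ract_ract x y m : ract (ract m x) y = ract m (mul x y) - lact x (ract m y).
Proof. by case: hM => _ [_ [_ [_ [_ [_ ]]]]]. Qed.

Let lactN x m : lact x (- m) = - lact x m.
Proof.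
have l0 : lact x 0 = 0 by have := lact_linr (-1) x 0 0; rewrite scaler0 addr0 scaleN1r addNr.
by rewrite -[- m]addr0 -scaleN1r lact_linr l0 addr0 scaleN1r.
Qed.
Let ractD x m n : ract (m + n) x = ract m x + ract n x.
Proof. by rewrite -[m]scale1r ract_linl !scale1r. Qed.
Let ract0 x : ract 0 x = 0.
Proof. by have := ract_linl (-1) x 0 0; rewrite scaler0 addr0 scaleN1r addNr. Qed.
Let ractN x m : ract (- m) x = - ract m x.
Proof. by rewrite -[- m]addr0 -scaleN1r ract_linl ract0 addr0 scaleN1r. Qed.

(* Cochains as iterated linear maps: [CL n.+1 = Hom(L, CL n)] makes the Cartan
   formula [i_x d + d i_x = theta_x] a recursive definition of [d]. *)
Fixpoint CL (n : nat) : vectType F := if n is k.+1 then 'Hom(L, CL k) else M.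

(** The Lie derivative: the action of L induced by the left action on [M] and by left multiplication
    on each argument. *)
Fixpoint theta (n : nat) : 'Hom(L, 'End(CL n)) :=
  match n with
  | 0 => linfun (fun x => linfun (lact x) : 'End(CL 0))
  | k.+1 => linfun (fun x => linfun (fun f : 'Hom(L, CL k) =>
      (theta k x \o f)%VF - (f \o lmult mul x)%VF) : 'End(CL k.+1))
  end.

(** The right action enters only in degree 0, with the sign of the last-argument term of the
    coboundary. *)
Fixpoint dif (n : nat) : 'Hom(CL n, CL n.+1) :=
  match n with
  | 0 => linfun (fun m : M => linfun (fun x => - ract m x) : CL 1)
  | k.+1 => linfun (fun f : 'Hom(L, CL k) =>
      linfun (fun x => theta k.+1 x f - dif k (f x)) : CL k.+2)
  end.

Lemma theta0E x (m : M) : theta 0 x m = lact x m.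
Proof.
have E y : linfun (lact y) =1 lact y by apply: linfun_linE.
rewrite /= linfun_linE => [|a u v]; first exact: E.
by apply/lfunP => w; rewrite add_lfunE scale_lfunE !E.
Qed.

Lemma thetaE n x (f : 'Hom(L, CL n)) y :
  (theta n.+1 x f : 'Hom(L, CL n)) y = theta n x (f y) - f (mul x y).
Proof.
have E z : linfun (fun f : 'Hom(L, CL n) => (theta n z \o f)%VF - (f \o lmult mul z)%VF)
    =1 (fun f : 'Hom(L, CL n) => (theta n z \o f)%VF - (f \o lmult mul z)%VF).
  apply: linfun_linE => a u v; apply/lfunP => w.
  rewrite !(add_lfunE, opp_lfunE, scale_lfunE, comp_lfunE) linearP scalerBr.
  zmodule.
rewrite [theta _]/= linfun_linE => [|a u v].
  by rewrite E add_lfunE opp_lfunE !comp_lfunE lmultE.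
apply/lfunP => g; rewrite add_lfunE scale_lfunE !E; apply/lfunP => w.
rewrite !(add_lfunE, opp_lfunE, scale_lfunE, comp_lfunE) linearP linearP /=.
rewrite !(add_lfunE, opp_lfunE, scale_lfunE, comp_lfunE) linearP scalerBr.
zmodule.
Qed.

Lemma dif0E (m : M) x : (dif 0 m : 'Hom(L, M)) x = - ract m x.
Proof.
have E (n : M) : linfun (fun x => - ract n x) =1 (fun x => - ract n x).
  by apply: linfun_linE => a u v; rewrite ract_linr scalerN opprD.
rewrite /= linfun_linE => [|a u v]; first exact: E.
by apply/lfunP => w; rewrite add_lfunE scale_lfunE !E ract_linl scalerN opprD.
Qed.

Lemma difE n (f : 'Hom(L, CL n)) x :
  (dif n.+1 f : 'Hom(L, CL n.+1)) x = theta n.+1 x f - dif n (f x).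
Proof.
have E (g : 'Hom(L, CL n)) : linfun (fun x => theta n.+1 x g - dif n (g x))
    =1 (fun x => theta n.+1 x g - dif n (g x)).
  apply: linfun_linE => a u v.
  rewrite [in LHS]linearP add_lfunE scale_lfunE [g _]linearP [dif _ _]linearP /= scalerBr.
  zmodule.
rewrite [dif _]/= linfun_linE => [|a u v]; first exact: E.
apply/lfunP => w; rewrite add_lfunE scale_lfunE !E add_lfunE scale_lfunE.
rewrite linearP [dif _ _]linearP /= scalerBr; zmodule.
Qed.

Arguments theta : simpl never.
Arguments dif : simpl never.

(** The bimodule axioms [lact_mul], [ract_lact] and [ract_ract] are the degree-zero cases of
    [theta_rep], [dif_theta] and [dif_dif]; the induction steps rest on the Leibniz identity and the
    Cartan formula. *)
Lemma theta_rep n : rep mul (theta n).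
Proof.
elim: n => [|n IHn] x y; apply/lfunP => f; rewrite lbrE.
  by rewrite !theta0E lact_mul.
have [_ _ leibid] := hL.
apply/lfunP => z; rewrite add_lfunE opp_lfunE !thetaE IHn lbrE !linearB /=.
have -> : mul (mul x y) z = mul x (mul y z) - mul y (mul x z) by rewrite leibid addrK.
rewrite linearB /=; zmodule.
Qed.

Lemma dif_theta n x f : dif n (theta n x f) = theta n.+1 x (dif n f).
Proof.
elim: n x f => [|n IHn] x f; apply/lfunP => y.
  by rewrite [RHS](@thetaE 0) !dif0E !theta0E ract_lact lactN; zmodule.
rewrite [RHS](@thetaE n.+1) !(@difE n) (@thetaE n) [dif n (_ - _)]linearB
  [theta n.+1 x (_ - _)]linearB /= IHn.
rewrite [theta n.+1 (mul x y)]theta_rep lbrE.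
zmodule.
Qed.

Lemma dif_dif n f : dif n.+1 (dif n f) = 0.
Proof.
elim: n f => [|n IHn] f; apply/lfunP => x.
  rewrite (@difE 0) zero_lfunE; apply/lfunP => y.
  rewrite zero_lfunE add_lfunE opp_lfunE (@thetaE 0) !dif0E theta0E.
  by rewrite lactN ractN ract_ract; zmodule.
rewrite (@difE n.+1) zero_lfunE (@difE n) [dif n.+1 (_ - _)]linearB /=.
by rewrite (@dif_theta n.+1) IHn; zmodule.
Qed.

Lemma cocycle_theta n (f : 'Hom(L, CL n)) x :
  dif n.+1 f = 0 -> theta n.+1 x f = dif n (f x).
Proof.
by move=> df; apply/eqP; rewrite -subr_eq0 -difE df zero_lfunE.
Qed.

(* [theta] acts trivially on cohomology, so complete reducibility makes every
   class invariant. *)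
Lemma invariant_cocycle n (f : CL n.+1) : dif n.+1 f = 0 ->
  exists g h, [/\ f = dif n g + h, dif n.+1 h = 0 & forall x, theta n.+1 x h = 0].
Proof.
move=> df.
have [||k /memv_imgP[g _ ->] gE] := invariant_complement charF hL hss
    (K := limg (dif n)) (f := f) (leqnn _) (theta_rep n.+1).
- by move=> x _ /memv_imgP[g _ ->]; rewrite -dif_theta memv_img ?memvf.
- by move=> x; rewrite cocycle_theta // memv_img ?memvf.
exists g, (f - dif n g); split=> //; first by zmodule.
by rewrite linearB /= df dif_dif subrr.
Qed.

Lemma dif_exact n (f : CL n.+2) : dif n.+2 f = 0 -> exists g, f = dif n.+1 g.
Proof.
case/invariant_cocycle => f0 [h [-> dh h_inv]].
suff [g ->] : exists g, h = dif n.+1 g by exists (f0 + g); rewrite linearD.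
have h0 x : dif n.+1 ((h : 'Hom(L, CL n.+1)) x) = 0.
  by rewrite -cocycle_theta.
have himg x : (h : 'Hom(L, CL n.+1)) x \in limg (dif n).
  rewrite memv_preim; apply: (semisimple_perfect charF hL hss) => u v.
  rewrite -memv_preim.
  have := h_inv u => /lfunP/(_ v); rewrite (@thetaE n.+1) zero_lfunE => /eqP.
  by rewrite subr_eq0 => /eqP <-; rewrite cocycle_theta // memv_img ?memvf.
pose g0 : 'Hom(L, CL n) := ((dif n)^-1 \o h)%VF.
have g0E x : dif n (g0 x) = (h : 'Hom(L, CL n.+1)) x.
  by rewrite comp_lfunE limg_lfunVK.
(* The linear lift [g0] ignores the action. Its failure to be equivariant lies in the submodule [K]
   of maps into cocycles, so an element of [K] can correct it. *)
have [||K KE] := @subspace_of_pred F (CL n.+1)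
    (fun g => forall x, dif n ((g : 'Hom(L, CL n)) x) = 0).
- by move=> x; rewrite zero_lfunE linear0.
- by move=> a u v u0 v0 x; rewrite add_lfunE scale_lfunE linearP /= u0 v0 scaler0 addr0.
have [||k /KE k0 kE] := invariant_complement charF hL hss
    (K := K) (f := g0 : CL n.+1) (leqnn _) (theta_rep n.+1).
- move=> x u /KE u0; apply/KE => y.
  by rewrite (@thetaE n) linearB /= dif_theta !u0 linear0 subrr.
- move=> x; apply/KE => y.
  rewrite (@thetaE n) linearB /= dif_theta !g0E -(@thetaE n.+1).
  by rewrite h_inv zero_lfunE.
(* On an invariant cochain [g] the Cartan formula leaves only [- dif n (g x)], whence the sign. *)
exists (- (g0 - k)); apply/lfunP => x.
rewrite (@difE n) linearN /= kE oppr0 opp_lfunE add_lfunE opp_lfunE.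
by rewrite linearN linearB /= g0E k0; zmodule.
Qed.

(** For an invariant cocycle [h], each [h x] is killed by the right action, hence by the left one;
    then [h (mul u v) = u . h v = 0], and products span L. *)
Lemma dif_exact_sym (f : CL 1) : symmetric_bimod lact ract ->
  dif 1 f = 0 -> exists m, f = dif 0 m.
Proof.
move=> symM /invariant_cocycle[g [h [-> dh h_inv]]].
suff -> : h = 0 by exists g; rewrite addr0.
have h0 x y : lact y ((h : 'Hom(L, M)) x) = 0.
  apply/eqP; rewrite -oppr_eq0 -symM -oppr_eq0 -dif0E -cocycle_theta //.
  by rewrite h_inv zero_lfunE.
apply/lfunP => x; rewrite zero_lfunE; apply/eqP; rewrite -memv0 memv_preim.
apply: (semisimple_perfect charF hL hss) => u v; rewrite -memv_preim memv0.
have := h_inv u => /lfunP/(_ v); rewrite (@thetaE 0) zero_lfunE theta0E h0 sub0r.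
by move/eqP; rewrite oppr_eq0.
Qed.

(** * Multilinear cochains as iterated linear maps *)

Fixpoint ev (n : nat) : CL n -> cochain L M n :=
  match n with
  | 0 => fun m _ => m
  | k.+1 => fun (f : 'Hom(L, CL k)) x => ev (f (x ord0)) (x \o lift ord0)
  end.

Lemma evP n a (f g : CL n) x : ev (a *: f + g) x = a *: ev f x + ev g x.
Proof.
elim: n f g x => [|n IHn] f g x //=.
by rewrite add_lfunE scale_lfunE IHn.
Qed.

Lemma ev0 n x : ev (0 : CL n) x = 0.
Proof. by have := evP (-1) (0 : CL n) 0 x; rewrite scaler0 addr0 scaleN1r addNr. Qed.

Lemma evD n (f g : CL n) x : ev (f + g) x = ev f x + ev g x.
Proof. by have := evP 1 f g x; rewrite !scale1r. Qed.

Lemma evN n (f : CL n) x : ev (- f) x = - ev f x.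
Proof. by have := evP (-1) f 0 x; rewrite addr0 ev0 addr0 !scaleN1r. Qed.

Lemma eq_ev n (f : CL n) x y : x =1 y -> ev f x = ev f y.
Proof. by move=> /functional_extensionality ->. Qed.

Definition ocons n (y : L) (x : 'I_n -> L) (i : 'I_n.+1) : L :=
  if unlift ord0 i is Some j then x j else y.

Lemma ev_inj n (f : CL n) : (forall x, ev f x = 0) -> f = 0.
Proof.
elim: n f => [|n IHn] f f0; first exact: (f0 (fun=> 0)).
apply/lfunP => y; rewrite zero_lfunE; apply: IHn => x.
rewrite -[RHS](f0 (ocons y x)) /= /ocons.
by rewrite unlift_none; apply: eq_ev => i /=; rewrite liftK.
Qed.

Lemma upd_lift0 n (x : 'I_n.+1 -> L) k u :
  upd x (lift ord0 k) u \o lift ord0 =1 upd (x \o lift ord0) k u.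
Proof. by move=> i; rewrite /upd /= (inj_eq lift_inj). Qed.

Lemma upd_ord0 n (x : 'I_n.+1 -> L) u : upd x ord0 u \o lift ord0 =1 x \o lift ord0.
Proof. by move=> i. Qed.

Lemma ev_multilinear n (f : CL n) : multilinear (ev f).
Proof.
elim: n f => [|n IHn] f x k a u v; first by case: k.
case: (unliftP ord0 k) => [k' ->|->] /=.
  by rewrite !(eq_ev _ (upd_lift0 x k' _)) /upd /= IHn.
by rewrite !(eq_ev _ (upd_ord0 x _)) /upd /= linearP evP.
Qed.

(** The induction hypothesis is used only with a basis vector as first argument, so finitely many
    witnesses are chosen and then extended linearly. *)
Lemma ev_surj n (f : cochain L M n) : multilinear f -> exists g : CL n, f = ev g.
Proof.
elim: n f => [|n IHn] f lf.
  exists (f (fun=> 0)); apply: functional_extensionality => x /=.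
  by congr f; apply: functional_extensionality; case.
have consE y (x : 'I_n -> L) k u : ocons y (upd x k u) = upd (ocons y x) (lift ord0 k) u.
  apply: functional_extensionality => i; rewrite /ocons /upd.
  by case: (unliftP ord0 i) => [j ->|->] /=; rewrite ?(inj_eq lift_inj).
have cons0 y z (x : 'I_n -> L) : ocons y x = upd (ocons z x) ord0 y.
  apply: functional_extensionality => i; rewrite /ocons /upd.
  by case: (unliftP ord0 i) => [j ->|->]; rewrite ?eqxx // eq_sym (negPf (neq_lift _ _)).
have cons_lin a u v (x : 'I_n -> L) : f (ocons (a *: u + v) x) = a *: f (ocons u x) + f (ocons v x).
  by rewrite (cons0 (a *: u + v) 0) (cons0 u 0) (cons0 v 0) lf.
have fE x : f x = f (ocons (x ord0) (x \o lift ord0)).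
  congr f; apply: functional_extensionality => i; rewrite /ocons.
  by case: (unliftP ord0 i) => [j ->|->].
set b := vbasis (fullv : {vspace L}).
have ex_e (i : 'I_(\dim {:L})) : exists h : CL n, (fun x => f (ocons b`_i x)) = ev h.
  by apply: IHn => x k a u v; rewrite !consE lf.
have [e eE] := fin_all_exists ex_e.
pose g : 'Hom(L, CL n) := linfun (fun y => \sum_i coord b i y *: e i).
have gE y : g y = \sum_i coord b i y *: e i.
  rewrite /g linfun_linE // => a u v; rewrite scaler_sumr -big_split; apply: eq_bigr => i _.
  by rewrite linearP scalerDl scalerA.
exists g; apply: functional_extensionality => x; rewrite fE /= gE.
move: (x \o lift ord0) => {}x'; rewrite {1}(coord_vbasis (memvf (x ord0))).
elim: (index_enum _) => [|i s IHs].
  rewrite !big_nil ev0.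
  by have := cons_lin (-1) 0 0 x'; rewrite scaler0 addr0 scaleN1r addNr.
by rewrite !big_cons evP -IHs cons_lin -eE.
Qed.

Lemma ev_theta n y (f : CL n) x :
  ev (theta n y f) x = lact y (ev f x) - \sum_j ev f (upd x j (mul y (x j))).
Proof.
elim: n f x => [|n IHn] f x; first by rewrite big_ord0 subr0 /= theta0E.
rewrite [LHS]/= (@thetaE n) evD evN IHn big_ord_recl /=.
rewrite (eq_ev _ (upd_ord0 x (mul y (x ord0)))).
rewrite (eq_bigr (fun j => ev (f (x ord0)) (upd (x \o lift ord0) j (mul y (x (lift ord0 j)))))).
  by rewrite /upd eqxx; zmodule.
by move=> j _; rewrite (eq_ev _ (upd_lift0 x j (mul y (x (lift ord0 j))))).
Qed.

(** The Cartan formula for the explicit coboundary: the terms with [i = 0] form the Lie derivative,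
    and all others keep [x ord0] as first argument while the index shift flips their sign. *)
Lemma coboundary_recl n (G : cochain L M n.+1) (x : 'I_n.+2 -> L) :
  let x' := x \o lift ord0 in
  coboundary mul lact ract G x = lact (x ord0) (G x')
    - \sum_j G (upd x' j (mul (x ord0) (x' j)))
    - coboundary mul lact ract (fun z : 'I_n -> L => G (ocons (x ord0) z)) x'.
Proof.
move=> x'; set g := fun z => G _.
have dropE (z : 'I_n.+2 -> L) i :
    z \o lift (lift ord0 i) = ocons (z ord0) (z \o lift ord0 \o lift i).
  apply: functional_extensionality => k; rewrite /ocons.
  case: (unliftP ord0 k) => [l ->|->] /=; congr z; apply: val_inj => //=.
  by rewrite /bump !add1n ltnS; case: (i <= l)%N.
have updE k u : upd x (lift ord0 k) u \o lift ord0 = upd x' k u.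
  exact/functional_extensionality/upd_lift0.
have T1 : \sum_(i < n.+2 | (i < n.+1)%N) (-1) ^+ i *: lact (x i) (G (x \o lift i))
    = lact (x ord0) (G x')
      - \sum_(i < n.+1 | (i < n)%N) (-1) ^+ i *: lact (x' i) (g (x' \o lift i)).
  rewrite big_mkcond big_ord_recl expr0 scale1r; congr (_ + _).
  rewrite -sumrN [RHS]big_mkcond; apply: eq_bigr => i _; rewrite lift0 ltnS.
  by case: ifP => // _; rewrite exprS mulN1r scaleNr dropE.
have T2 : (-1) ^+ n.+2 *: ract (G (x \o lift ord_max)) (x ord_max)
    = - ((-1) ^+ n.+1 *: ract (g (x' \o lift ord_max)) (x' ord_max)).
  have -> : ord_max = lift ord0 ord_max :> 'I_n.+2 by apply: val_inj.
  by rewrite exprS mulN1r scaleNr dropE.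
have T3 : \sum_(i < n.+2) \sum_(j < n.+2 | (i < j)%N)
      (-1) ^+ i.+1 *: G (upd x j (mul (x i) (x j)) \o lift i)
    = - \sum_j G (upd x' j (mul (x ord0) (x' j)))
      - \sum_(i < n.+1) \sum_(j < n.+1 | (i < j)%N)
      (-1) ^+ i.+1 *: g (upd x' j (mul (x' i) (x' j)) \o lift i).
  rewrite big_ord_recl; congr (_ + _).
    rewrite big_mkcond big_ord_recl ltnn; apply: etrans (add0r _) _; rewrite -sumrN; apply: eq_bigr => k _.
    by rewrite expr1 scaleN1r updE.
  rewrite -sumrN; apply: eq_bigr => i _; rewrite big_mkcond big_ord_recl.
  rewrite ltn0; apply: etrans (add0r _) _.
  rewrite -sumrN [RHS]big_mkcond; apply: eq_bigr => k _; rewrite !lift0 ltnS.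
  by case: ifP => // _; rewrite exprS mulN1r scaleNr dropE updE.
rewrite /coboundary T1 T2 T3; zmodule.
Qed.

Lemma coboundary_ev n (f : CL n) x :
  coboundary mul lact ract (ev f) x = ev (dif n f) x.
Proof.
elim: n f x => [|n IHn] f x.
  rewrite /coboundary big_pred0 => [|i]; last by rewrite ltn0.
  rewrite [X in _ + X]big1 => [|i _]; last first.
    by rewrite big_pred0 // => j; rewrite !ord1.
  by rewrite add0r addr0 expr1 scaleN1r /= dif0E; congr (- ract _ (x _)); apply/val_inj.
rewrite coboundary_recl.
rewrite -[RHS]/(ev ((dif n.+1 f : 'Hom(L, CL n.+1)) (x ord0)) (x \o lift ord0)).
rewrite (@difE n) evD evN -IHn ev_theta.
congr (_ - coboundary mul lact ract _ _); apply: functional_extensionality => z /=.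
rewrite /ocons unlift_none; apply: eq_ev => i /=; by rewrite liftK.
Qed.

Lemma coboundary_ev0 n (f : CL n) :
  (forall x, coboundary mul lact ract (ev f) x = 0) <-> dif n f = 0.
Proof.
split=> [f0|f0 x]; last by rewrite coboundary_ev f0 ev0.
by apply: ev_inj => x; rewrite -coboundary_ev.
Qed.

Lemma HL_vanishes_dif n :
  (forall f : CL n.+1, dif n.+1 f = 0 -> exists g, f = dif n g) ->
  HL_vanishes mul lact ract n.
Proof.
move=> exact_n f /ev_surj[g ->] /coboundary_ev0/exact_n[h ->].
exists (ev h); split=> [|x]; first exact: ev_multilinear.
by rewrite coboundary_ev.
Qed.

(** * The five-term exact sequence *)

Lemma HL0E m : HL0 mul lact ract m <-> forall x, ract m x = 0.
Proof.
rewrite /HL0; have := @coboundary_ev0 0 m; rewrite /= => ->.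
split=> [m0 x|m0]; first by apply/eqP; rewrite -oppr_eq0 -dif0E m0 zero_lfunE.
by apply/lfunP => x; rewrite dif0E m0 oppr0 zero_lfunE.
Qed.

Lemma Z1E (phi : 'Hom(L, M)) : Z1 mul lact ract phi <-> dif 1 (phi : CL 1) = 0.
Proof. exact: (@coboundary_ev0 1 phi). Qed.

Lemma B1E (phi : 'Hom(L, M)) : B1 mul lact ract phi <-> exists m, phi = dif 0 m.
Proof.
split=> [[m mE]|[m ->]]; exists m.
  apply/lfunP => x; have := mE (fun=> x); rewrite /as_cochain1 => ->.
  exact: (@coboundary_ev 0 m).
by move=> y; rewrite (@coboundary_ev 0 m).
Qed.

Lemma M0_vspace : exists W : {vspace M}, forall v, v \in W <-> M0 lact ract v.
Proof.
apply: subspace_of_pred => [|a u v [s ->] [t ->]]; first by exists [::]; rewrite big_nil.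
exists ([seq (a * p.1.1, p.1.2, p.2) | p <- s] ++ t).
rewrite big_cat big_map scaler_sumr; congr (_ + _); apply: eq_bigr => p _.
by rewrite scalerA.
Qed.

Lemma M0_gen x m : M0 lact ract (lact x m + ract m x).
Proof. by exists [:: (1, x, m)]; rewrite big_seq1 scale1r. Qed.

(** The two axioms for iterated right actions cancel on each generator [x . m + m . x]. *)
Lemma ract_M0 v x : M0 lact ract v -> ract v x = 0.
Proof.
case=> s ->; elim: s => [|p s IHs]; first by rewrite big_nil ract0.
rewrite big_cons ract_linl IHs ractD ract_lact ract_ract addr0.
by rewrite addrA subrK subrr scaler0.
Qed.

Lemma five_term : five_term_exact mul lact ract.
Proof.
have [W WE] := M0_vspace.
have M0B u v : M0 lact ract u -> M0 lact ract v -> M0 lact ract (u - v).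
  by rewrite -!WE => uW vW; rewrite rpredB.
have M0_sub u v : M0 lact ract (u - v) -> M0 lact ract v -> M0 lact ract u.
  by rewrite -!WE => uvW vW; rewrite -[u](subrK v) rpredD.
have M0_0 : M0 lact ract 0 by rewrite -WE mem0v.
(* All maps but the third are the identity on representatives. The connecting map sends [m] to
   [x |-> - m . x], which agrees with [x . m] modulo [M_0] and therefore lands in [M_0]. *)
exists id, id, (dif 0 : M -> 'Hom(L, M)), id; split; last split; last split;
  last split; last split; last split; last split; last split.
- split=> // u uM; apply/HL0E => x; exact: ract_M0.
- split=> // [u /HL0E u0 x|u ->] //.
  by have := M0_gen x u; rewrite u0 addr0.
- split=> [a u v _ _|u uC|u uM].
  + by rewrite linearP.
  + split=> [x|x y]; rewrite !dif0E.
      have := M0B _ _ (uC x) (M0_gen x u); by rewrite opprD addrA subrr sub0r.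
    (* Expanding [(x . u) . y = 0] gives the equivariance of the connecting map. *)
    have := ract_M0 y (uC x); rewrite ract_lact lactN => /eqP.
    by rewrite subr_eq0 => /eqP->.
  + by apply/lfunP => x; rewrite dif0E (ract_M0 x uM) oppr0 zero_lfunE.
- split=> // [u [uM uL]|u ->].
    apply/Z1E/lfunP => x; rewrite (@difE 0) zero_lfunE; apply/lfunP => y.
    rewrite add_lfunE opp_lfunE (@thetaE 0) dif0E theta0E uL (ract_M0 y (uM x)) zero_lfunE.
    by zmodule.
  by apply/B1E; exists 0; rewrite linear0.
- by [].
- move=> u uB; split=> [uM|[v [vM /eqP]]]; first by exists u; rewrite /zero_pred subrr.
  by rewrite subr_eq0 => /eqP->.
- move=> u uC; split=> [u0|[v [/HL0E v0 uvM]]].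
    exists u; rewrite subrr; split=> //; apply/HL0E => x; apply/eqP.
    by rewrite -oppr_eq0 -dif0E u0 zero_lfunE.
  apply/lfunP => x; rewrite dif0E zero_lfunE -[u](subrK v) ractD v0 addr0.
  by rewrite (ract_M0 x uvM) oppr0.
- move=> u [uM uL]; split=> [/B1E[m um]|[m [mC /eqP]]]; last first.
    by rewrite subr_eq0 => /eqP um; apply/B1E; exists m.
  exists m; split; last by rewrite /zero_pred um subrr.
  (* [x . m] is the generator [x . m + m . x] plus [u x = - m . x]. *)
  move=> x; apply: (M0_sub _ (u x)) (uM x).
  by rewrite um dif0E opprK; apply: M0_gen.
- move=> u /Z1E/invariant_cocycle[m [h [uE dh h_inv]]]; exists h; split; last first.
    by apply/B1E; exists m; rewrite uE addrK.
  have hL' x y : (h : 'Hom(L, M)) (mul x y) = lact x ((h : 'Hom(L, M)) y).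
    have := h_inv x => /lfunP/(_ y); rewrite (@thetaE 0) theta0E zero_lfunE => /eqP.
    by rewrite subr_eq0 => /eqP->.
  have hR x y : ract ((h : 'Hom(L, M)) x) y = 0.
    by apply/eqP; rewrite -oppr_eq0 -dif0E -cocycle_theta // h_inv zero_lfunE.
  (* Products span L, and [h (mul y z) = y . h z = y . h z + h z . y] is a generator of [M_0]. *)
  split=> // x; apply/WE; rewrite memv_preim.
  apply: (semisimple_perfect charF hL hss) => y z; rewrite -memv_preim hL'.
  by apply/WE; have := M0_gen y ((h : 'Hom(L, M)) z); rewrite hR addr0.
Qed.

End Cohomology.

Theorem theorem4p3 (F : fieldType) (hF : [pchar F] =i pred0)
  (L : vectType F) (mul : L -> L -> L)
  (hL : leibniz_algebra mul) (hss : semisimple mul)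
  (M : vectType F) (lact : L -> M -> M) (ract : M -> L -> M)
  (hM : bimodule mul lact ract) :
  (forall n : nat, (1 <= n)%N -> HL_vanishes mul lact ract n) /\
  five_term_exact mul lact ract /\
  (symmetric_bimod lact ract -> forall n : nat, HL_vanishes mul lact ract n).
Proof.
(* The index [n] of [HL_vanishes] stands for degree [n + 1], so [1 <= n] means degree at least
   two. *)
have HLn n : (1 <= n)%N -> HL_vanishes mul lact ract n.
  by case: n => // n _; apply: (HL_vanishes_dif hL hM) => f; apply: (dif_exact hF hL hss hM).
split=> //; split=> [|symM [|n]]; first exact: (five_term hF hL hss hM).
  by apply: (HL_vanishes_dif hL hM) => f; apply: (dif_exact_sym hF hL hss hM).
exact: HLn.
Qed.
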